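(* Let $M\subseteq\mathbb{R}^d$ be a $C^{1,1}$ submanifold, and let $\vartheta:\nu_1(M)\to(0,\infty]$ be its frontier function. Then (1) $\vartheta$ is lower semi-continuous; (2) if $M$ is a $C^2$ submanifold, then $\vartheta$ is continuous.
   Context: Submanifolds are nonempty. Let $0\le m<d$. A set $M\subseteq\mathbb{R}^d$ is an $m$-dimensional $C^k$ submanifold of $\mathbb{R}^d$ if for every $\xi\in M$ there are open sets $U,V\subseteq\mathbb{R}^d$ with $\xi\in U$ and a $C^k$ diffeomorphism $\Psi:V\to U$ such that for all $y\in V$: $\Psi(y)\in M\iff y_{m+1}=\dots=y_d=0$. The case $m=d$ is excluded throughout. $T_\xi(M)$ denotes the tangent space (a linear subspace of $\mathbb{R}^d$). Let $S$ be the unit sphere of $\mathbb{R}^d$. For $m$-dimensional linear subspaces $T_1,T_2$ put $d_H(T_1,T_2):=\sup_{t_1\in T_1\cap S}\inf_{t_2\in T_2\cap S}\|t_2-t_1\|$. For $m\ge1$, $M$ is an $m$-dimensional $C^{1,1}$ submanifold if it is an $m$-dimensional $C^1$ submanifold and $\xi\mapsto T_\xi(M)$ is locally Lipschitz with respect to $d_H$: every point of $M$ has a relatively open neighborhood $V\subseteq M$ and a constant $L>0$ with $d_H(T_\zeta(M),T_\eta(M))\le L\|\zeta-\eta\|$ for all $\zeta,\eta\in V$. $d(x,M)=\inf_{\xi\in M}\|x-\xi\|$ (Euclidean norm). $\operatorname{unpp}(M)$ is the set of $x\in\mathbb{R}^d$ for which there is exactly one $\xi\in M$ with $\|x-\xi\|=d(x,M)$.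 $\mathcal{E}(M)$ is the interior of $\operatorname{unpp}(M)$. $\nu_1(M):=\{(\xi,v)\in\mathbb{R}^d\times\mathbb{R}^d:\xi\in M,\ v\perp T_\xi(M),\ \|v\|=1\}$ with the subspace topology. The frontier function is $\vartheta(\xi,v):=\sup\{r>0:\ ]\xi,\xi+rv[\ \subseteq\mathcal{E}(M)\}\in(0,\infty]$, where $]a,b[$ is the open line segment $\{(1-\lambda)a+\lambda b:\lambda\in(0,1)\}$. *)

(* Defs.v *)
From HB Require Import structures.
From mathcomp Require Import all_boot all_order all_algebra.
From mathcomp Require Import all_classical all_reals all_analysis.
Set Implicit Arguments.
Unset Strict Implicit.
Unset Printing Implicit Defensive.
Import Order.TTheory GRing.Theory Num.Theory.
Import numFieldNormedType.Exports.
Local Open Scope classical_set_scope.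
Local Open Scope ring_scope.

(* The library norm on 'rV[R]_d is the sup norm. It induces the topology (and
   the notion of differentiability) of R^d; metric notions use [enorm]. *)
Definition dotp (R : realType) (d : nat) (u v : 'rV[R]_d) : R :=
  \sum_(i < d) u 0 i * v 0 i.

Definition enorm (R : realType) (d : nat) (u : 'rV[R]_d) : R :=
  Num.sqrt (dotp u u).

(* [Ck k f A]: f is of class C^k on A. Only meaningful for A open and a
   finite-dimensional source, where it suffices that every directional
   derivative be of class C^(k-1). *)
Fixpoint Ck (R : realType) (V W : normedModType R) (k : nat) (f : V -> W)
    (A : set V) : Prop :=
  match k with
  | 0 => forall x, A x -> {for x, continuous f}
  | k'.+1 => (forall x, A x -> differentiable f x) /\
             (forall v : V, Ck k' ('D_v f) A)
  end.

Definition Ck_diffeo (R : realType) (d k : nat) (V U : set 'rV[R]_d)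
    (Psi : 'rV[R]_d -> 'rV[R]_d) : Prop :=
  [/\ set_bij V U Psi, Ck k Psi V &
      exists Phi : 'rV[R]_d -> 'rV[R]_d,
        {in V, cancel Psi Phi} /\ Ck k Phi U].

(* Coordinates are numbered from 0, so y_(m+1) = ... = y_d = 0 concerns the
   indices i >= m. *)
Definition Ck_submanifold (R : realType) (d k m : nat) (M : set 'rV[R]_d)
    : Prop :=
  [/\ (m < d)%N, M !=set0 &
      forall xi, M xi ->
        exists U V : set 'rV[R]_d, exists Psi : 'rV[R]_d -> 'rV[R]_d,
          [/\ open U, open V, U xi, Ck_diffeo k V U Psi &
              forall y, V y ->
                (M (Psi y) <-> forall i : 'I_d, (m <= i)%N -> y 0 i = 0)]].

(* Velocities at xi of the C^1 curves in M through xi. *)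
Definition tangent_space (R : realType) (d : nat) (M : set 'rV[R]_d)
    (xi : 'rV[R]_d) : set 'rV[R]_d :=
  [set v | exists e : R, exists c : R -> 'rV[R]_d,
    [/\ 0 < e, Ck 1 c `]- e, e[, (forall t, t \in `]- e, e[ -> M (c t)),
        c 0 = xi & derive1 c 0 = v]].

Definition usphere (R : realType) (d : nat) : set 'rV[R]_d :=
  [set u | enorm u = 1].

(* Real-valued sup and inf: for nonzero subspaces both are taken over nonempty
   subsets of [0, 2]. *)
Definition subspace_dist (R : realType) (d : nat) (T1 T2 : set 'rV[R]_d) : R :=
  sup [set inf [set enorm (t2 - t1) | t2 in T2 `&` @usphere R d]
      | t1 in T1 `&` @usphere R d].

Definition C11_submanifold (R : realType) (d m : nat) (M : set 'rV[R]_d)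
    : Prop :=
  [/\ (0 < m)%N, Ck_submanifold 1 m M &
      forall xi, M xi ->
        exists W : set 'rV[R]_d, exists L : R,
          [/\ open W, W xi, 0 < L &
              forall zeta eta, (W `&` M) zeta -> (W `&` M) eta ->
                subspace_dist (tangent_space M zeta) (tangent_space M eta)
                  <= L * enorm (zeta - eta)]].

Definition dist (R : realType) (d : nat) (x : 'rV[R]_d) (M : set 'rV[R]_d)
    : R :=
  inf [set enorm (x - xi) | xi in M].

Definition unpp (R : realType) (d : nat) (M : set 'rV[R]_d) : set 'rV[R]_d :=
  [set x | exists! xi, M xi /\ enorm (x - xi) = dist x M].

Definition calE (R : realType) (d : nat) (M : set 'rV[R]_d) : set 'rV[R]_d :=
  (unpp M)°.

Definition nu1 (R : realType) (d : nat) (M : set 'rV[R]_d)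
    : set ('rV[R]_d * 'rV[R]_d) :=
  [set p | [/\ M p.1, (forall t, tangent_space M p.1 t -> dotp p.2 t = 0) &
               enorm p.2 = 1]].

Definition open_segment (R : realType) (d : nat) (a b : 'rV[R]_d)
    : set 'rV[R]_d :=
  [set (1 - l) *: a + l *: b | l in `]0, 1[].

(* Defined on all pairs, but only its restriction to [nu1 M] is of interest. *)
Definition frontier_fun (R : realType) (d : nat) (M : set 'rV[R]_d)
    (p : 'rV[R]_d * 'rV[R]_d) : \bar R :=
  ereal_sup [set r%:E | r in
    [set r : R | 0 < r /\ open_segment p.1 (p.1 + r *: p.2) `<=` calE M]].

(* Main.v *)
(* For z, y in M near a given point and n normal to M at z, a C^{1,1} bound on
   the tangent spaces gives <n, y - z> <= C |n| |y - z|^2: along a chart segment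
   from z to y the velocities are tangent to M, hence nearly tangent at z. So a
   point near M cannot have two nearest points, i.e. M lies in the open set E(M).
   An initial closed piece of a normal ray in E(M) is then a compact subset of
   E(M), and nearby normal rays stay in E(M) equally long: theta is positive and
   lower semicontinuous.

   The distance function has slope 1 everywhere on E(M) \ M, so a point x of E(M)
   with nearest point z can be pushed further along the ray from z through x
   without changing its nearest point. Hence z is nearest to z + t v whenever
   t < theta(z, v). If conversely z is nearest to z + b v and M is C^2, the second
   order condition at z + b v makes the Hessian of the squared distance positive
   definite at z + t v for t < b; by local strict convexity z + t v is in E(M),
   so theta(z, v) >= b. Therefore theta(z, v) < b yields y in M with
   |z + b v - y| < b, an open condition on (z, v): theta is upper semicontinuous. *)
Require Import Defs.
From mathcomp Require Import all_boot all_order all_algebra.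
From mathcomp Require Import all_classical all_reals all_analysis.
From mathcomp Require Import ring lra.
Import Order.TTheory GRing.Theory Num.Theory.
Import numFieldNormedType.Exports.
Local Open Scope classical_set_scope.
Local Open Scope ring_scope.

Set Implicit Arguments.
Unset Strict Implicit.
Unset Printing Implicit Defensive.

(** * Euclidean geometry *)

Section Euclidean.
Context {R : realType} {d : nat}.
Implicit Types u v w : 'rV[R]_d.

Lemma dotpC u v : dotp u v = dotp v u.
Proof. by apply: eq_bigr => i _; rewrite mulrC. Qed.

Lemma dotpDl u v w : dotp (u + v) w = dotp u w + dotp v w.
Proof. by rewrite -big_split; apply: eq_bigr => i _; rewrite !mxE mulrDl. Qed.

Lemma dotpZl a u v : dotp (a *: u) v = a * dotp u v.
Proof. by rewrite /dotp big_distrr; apply: eq_bigr => i _; rewrite !mxE/= mulrA. Qed.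

Lemma dotpNl u v : dotp (- u) v = - dotp u v.
Proof. by rewrite -scaleN1r dotpZl mulN1r. Qed.

Lemma dotpBl u v w : dotp (u - v) w = dotp u w - dotp v w.
Proof. by rewrite dotpDl dotpNl. Qed.

Lemma dotpDr u v w : dotp w (u + v) = dotp w u + dotp w v.
Proof. by rewrite !(dotpC w) dotpDl. Qed.

Lemma dotpZr a u v : dotp u (a *: v) = a * dotp u v.
Proof. by rewrite !(dotpC u) dotpZl. Qed.

Lemma dotpNr u v : dotp v (- u) = - dotp v u.
Proof. by rewrite !(dotpC v) dotpNl. Qed.

Lemma dotpBr u v w : dotp w (u - v) = dotp w u - dotp w v.
Proof. by rewrite dotpDr dotpNr. Qed.

Lemma dotp0l u : dotp 0 u = 0.
Proof. by rewrite -(scale0r u) dotpZl mul0r. Qed.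

Lemma dotp0r u : dotp u 0 = 0.
Proof. by rewrite dotpC dotp0l. Qed.

Definition dotpE := (dotpDl, dotpBl, dotpNl, dotpZl, dotpDr, dotpBr, dotpNr, dotpZr).

Lemma dotp_ge0 u : 0 <= dotp u u.
Proof. by apply: sumr_ge0 => i _; rewrite -expr2 sqr_ge0. Qed.

Lemma dotp_suml (I : Type) (r : seq I) (F : I -> 'rV[R]_d) v :
  dotp (\sum_(i <- r) F i) v = \sum_(i <- r) dotp (F i) v.
Proof. by elim/big_rec2 : _ => [|i a u _ <-]; rewrite ?dotp0l ?dotpDl. Qed.

Lemma dotp_sumr (I : Type) (r : seq I) (F : I -> 'rV[R]_d) v :
  dotp v (\sum_(i <- r) F i) = \sum_(i <- r) dotp v (F i).
Proof. by rewrite dotpC dotp_suml; apply: eq_bigr => i _; rewrite dotpC. Qed.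

Lemma enorm_ge0 u : 0 <= enorm u.
Proof. exact: sqrtr_ge0. Qed.

Lemma sqr_enorm u : enorm u ^+ 2 = dotp u u.
Proof. by rewrite sqr_sqrtr// dotp_ge0. Qed.

Lemma sqr_enormD u v :
  enorm (u + v) ^+ 2 = enorm u ^+ 2 + 2 * dotp u v + enorm v ^+ 2.
Proof. rewrite !sqr_enorm !dotpE (dotpC v u); ring. Qed.

Lemma sqr_enormB u v :
  enorm (u - v) ^+ 2 = enorm u ^+ 2 - 2 * dotp u v + enorm v ^+ 2.
Proof. rewrite !sqr_enorm !dotpE (dotpC v u); ring. Qed.

Lemma enormN u : enorm (- u) = enorm u.
Proof. by rewrite /enorm !dotpE opprK. Qed.

Lemma enormC u v : enorm (u - v) = enorm (v - u).
Proof. by rewrite -enormN opprB. Qed.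

Lemma enormZ a u : enorm (a *: u) = `|a| * enorm u.
Proof. by rewrite /enorm !dotpE mulrA -expr2 sqrtrM ?sqr_ge0// sqrtr_sqr. Qed.

Lemma enorm0 : enorm (0 : 'rV[R]_d) = 0.
Proof. by rewrite /enorm dotp0l sqrtr0. Qed.

Lemma normr_le_enorm u : `|u| <= enorm u.
Proof.
rewrite [leLHS]/Num.norm/= mx_normrE; apply: bigmax_le => [|[i j] _ /=].
  exact: enorm_ge0.
rewrite -sqrtr_sqr; apply: ler_wsqrtr.
by rewrite /dotp (bigD1 j)//= (ord1 i) expr2 lerDl sumr_ge0// => k _;
  rewrite -expr2 sqr_ge0.
Qed.

Lemma coord_le_normr u i : `|u 0 i| <= `|u|.
Proof.
rewrite [leRHS]/Num.norm/= mx_normrE.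
exact: (le_bigmax _ (fun ij : 'I_1 * 'I_d => `|u ij.1 ij.2|) (0, i)).
Qed.

(** The crude constant [d + 1] is enough to compare topologies and stays positive for [d = 0]. *)
Lemma enorm_le_normr u : enorm u <= (d%:R + 1) * `|u|.
Proof.
have d0 : 0 <= d%:R :> R by [].
rewrite -(@ler_pXn2r _ 2)//; last 2 first.
- by rewrite nnegrE enorm_ge0.
- by rewrite nnegrE mulr_ge0 ?addr_ge0.
rewrite sqr_enorm (@le_trans _ _ (\sum_(i < d) `|u| ^+ 2))//.
  apply: ler_sum => i _; rewrite -expr2 -real_normK ?num_real//.
  by rewrite ler_pXn2r ?nnegrE// coord_le_normr.
rewrite sumr_const card_ord exprMn -[leLHS]mulr_natl ler_wpM2r ?sqr_ge0//.
nra.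
Qed.

Lemma enorm_eq0 u : enorm u = 0 -> u = 0.
Proof.
by move=> u0; apply/eqP; rewrite -normr_le0 -u0 normr_le_enorm.
Qed.

Lemma enorm_gt0 u : u != 0 -> 0 < enorm u.
Proof.
move=> u0; rewrite lt_neqAle enorm_ge0 andbT eq_sym.
by apply: contra_neq u0; exact: enorm_eq0.
Qed.

(** Cauchy-Schwarz, by expanding the squared norm of [enorm v *: u - enorm u *: v]. *)
Lemma dotp_le u v : dotp u v <= enorm u * enorm v.
Proof.
have [->|v0] := eqVneq v 0; first by rewrite dotp0r enorm0 mulr0.
have [->|u0] := eqVneq u 0; first by rewrite dotp0l enorm0 mul0r.
have nu := enorm_gt0 u0.
have nv := enorm_gt0 v0.
have : 0 <= enorm (enorm v *: u - enorm u *: v) ^+ 2 by rewrite sqr_ge0.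
rewrite sqr_enormB !enormZ !dotpE !(ger0_norm (enorm_ge0 _)).
rewrite (_ : _ + _ = 2 * (enorm u * enorm v) * (enorm u * enorm v - dotp u v)).
  by rewrite pmulr_rge0 ?subr_ge0// !mulr_gt0.
ring.
Qed.

Lemma dotp_abs_le u v : `|dotp u v| <= enorm u * enorm v.
Proof. by rewrite ler_norml dotp_le andbT lerNl -dotpNl -(enormN u) dotp_le. Qed.

Lemma enormD u v : enorm (u + v) <= enorm u + enorm v.
Proof.
rewrite -(@ler_pXn2r _ 2) ?nnegrE ?addr_ge0 ?enorm_ge0//.
rewrite sqr_enormD; have := dotp_le u v; nra.
Qed.

Lemma enorm_triangle w u v : enorm (u - v) <= enorm (u - w) + enorm (w - v).
Proof. by rewrite -[u - v](subrKA w); exact: enormD. Qed.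

Lemma enorm_sum (I : Type) (r : seq I) (P : pred I) (F : I -> 'rV[R]_d) :
  enorm (\sum_(i <- r | P i) F i) <= \sum_(i <- r | P i) enorm (F i).
Proof.
elim/big_ind2 : _ => [|x a y b xa yb|//]; first by rewrite enorm0.
exact: le_trans (enormD _ _) (lerD xa yb).
Qed.

Lemma enorm_ball_convex (x y z : 'rV[R]_d) (r s : R) : enorm (y - x) < r ->
  enorm (z - x) < r -> 0 <= s <= 1 -> enorm (y + s *: (z - y) - x) < r.
Proof.
move=> yr zr /andP[s0 s1].
have -> : y + s *: (z - y) - x = s *: (z - x) + (1 - s) *: (y - x).
  by apply/rowP => i; rewrite !mxE; ring.
rewrite (le_lt_trans (enormD _ _))// !enormZ !ger0_norm ?subr_ge0//.
by have [yz|/ltW zy] := leP (enorm (y - x)) (enorm (z - x)); nra.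
Qed.

(** Equality case of the triangle inequality: squaring the last hypothesis gives
    [enorm u * s <= dotp u v], so the squared norm of the difference of the two sides is at most
    [s^2 - 2 s^2 + s^2 = 0]. *)
Lemma enorm_colinear u v (s : R) : 0 < enorm u -> 0 <= s ->
  enorm v <= s -> enorm u + s <= enorm (u + v) -> v = (s / enorm u) *: u.
Proof.
move=> u0 s0 vs usv; apply/eqP; rewrite -subr_eq0; apply/eqP/enorm_eq0.
have v0 := enorm_ge0 v.
have H : enorm u * s <= dotp u v.
  have : (enorm u + s) ^+ 2 <= enorm (u + v) ^+ 2.
    by rewrite ler_pXn2r// nnegrE ?addr_ge0 ?enorm_ge0.
  rewrite sqr_enormD; nra.
apply/eqP; rewrite -sqrf_eq0 eq_le sqr_ge0 andbT.
rewrite sqr_enormB enormZ ger0_norm ?divr_ge0 ?enorm_ge0//.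
rewrite divfK ?gt_eqF// dotpZr dotpC.
have : s / enorm u * (enorm u * s) <= s / enorm u * dotp u v.
  by rewrite ler_wpM2l// divr_ge0 ?enorm_ge0.
rewrite mulrA divfK ?gt_eqF//; nra.
Qed.

(** Translates between the sup-norm topology and the Euclidean balls in which the estimates are
    made. *)
Lemma enorm_nbhsP (x : 'rV[R]_d) (A : set 'rV[R]_d) :
  nbhs x A <-> exists2 e : R, 0 < e & forall y, enorm (y - x) < e -> A y.
Proof.
split=> [/nbhs_normP[e e0 xeA]|[e e0 xeA]].
  exists e => // y yx; apply: xeA => /=.
  by rewrite distrC (le_lt_trans (normr_le_enorm _)).
have d0 : 0 < d%:R + 1 :> R by rewrite ltr_wpDl.
apply/nbhs_ballP; exists (e / (d%:R + 1)); first by rewrite /= divr_gt0.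
move=> y; rewrite -ball_normE /=; rewrite distrC => yx; apply: xeA.
rewrite (le_lt_trans (enorm_le_normr _))// mulrC -ltr_pdivlMr//.
Qed.

Lemma enorm_ball_nbhs (x : 'rV[R]_d) (e : R) : 0 < e ->
  nbhs x [set y | enorm (y - x) < e].
Proof. by move=> e0; apply/enorm_nbhsP; exists e. Qed.

Lemma dotp_cvg (T : Type) (F : set_system T) {FF : Filter F}
    (f g : T -> 'rV[R]_d) u v :
  f @ F --> u -> g @ F --> v -> (fun t => dotp (f t) (g t)) @ F --> dotp u v.
Proof.
move=> fu gv; apply: cvg_big => [|i _]; first exact: add_continuous.
apply: cvgM.
  exact: (cvg_comp _ _ fu (@coord_continuous _ _ _ 0 i u)).
exact: (cvg_comp _ _ gv (@coord_continuous _ _ _ 0 i v)).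
Qed.

Lemma enorm_continuous : continuous (@enorm R d).
Proof.
move=> x; apply: (@cvg_comp _ _ _ (fun u => dotp u u) Num.sqrt).
  exact: (@dotp_cvg _ (nbhs x) _ id id x x cvg_id cvg_id).
exact: sqrt_continuous.
Qed.

Lemma enorm_closed_ball_compact (x : 'rV[R]_d) (r : R) :
  compact [set y | enorm (y - x) <= r].
Proof.
apply: bounded_closed_compact.
  exists (`|x| + r); split; first exact: num_real.
  move=> M xrM y /= yr; apply: le_trans (ltW xrM).
  rewrite -[y](subrK x) (le_trans (ler_normD _ _))// addrC lerD2l.
  exact: le_trans (normr_le_enorm _) yr.
have ec : continuous (fun y : 'rV[R]_d => enorm (y - x)).
  move=> y; apply: (@cvg_comp _ _ _ (fun u => u - x) (@enorm R d) (nbhs y)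
    (nbhs (y - x))); last exact: enorm_continuous.
  exact: (cvgB (@cvg_id _ (nbhs y)) (cvg_cst x)).
exact: ((continuous_closedP _).1 ec _ (@closed_le _ r)).
Qed.

End Euclidean.

(** * Nearest points *)

Lemma common_lower_bound (R : realType) (a b : R) : 0 < a -> 0 < b ->
  exists2 h : R, 0 < h & h <= a /\ h <= b.
Proof.
by move=> a0 b0; exists (Num.min a b); rewrite ?lt_min ?a0 ?ge_min ?lexx ?orbT.
Qed.

Section Distance.
Context {R : realType} {d : nat}.
Variable M : set 'rV[R]_d.
Implicit Types x y z v : 'rV[R]_d.

Lemma dist_le x z : M z -> dist x M <= enorm (x - z).
Proof.
move=> Mz; apply: ge_inf; last by exists z.
by exists 0 => _ [y _ <-]; exact: enorm_ge0.
Qed.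

Lemma dist_ge x c : M !=set0 -> (forall z, M z -> c <= enorm (x - z)) ->
  c <= dist x M.
Proof.
move=> [z Mz] xc; apply: lb_le_inf; first by exists (enorm (x - z)), z.
by move=> _ [y My <-]; exact: xc.
Qed.

Lemma dist_lip x y : M !=set0 -> dist x M <= dist y M + enorm (x - y).
Proof.
move=> M0; rewrite -lerBlDr; apply: dist_ge => // z Mz.
rewrite lerBlDr (le_trans (dist_le x Mz))// [leRHS]addrC.
exact: enorm_triangle.
Qed.

Lemma dist_approx x (e : R) : M !=set0 -> 0 < e ->
  exists2 z, M z & enorm (x - z) < dist x M + e.
Proof.
move=> [z0 Mz0] e0.
have hi : has_inf [set enorm (x - z) | z in M].
  split; first by exists (enorm (x - z0)), z0.
  by exists 0 => _ [y _ <-]; exact: enorm_ge0.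
by have [_ [z Mz <-] ?] := inf_adherent e0 hi; exists z.
Qed.

Lemma dist_continuous : M !=set0 -> continuous (fun x => dist x M).
Proof.
move=> M0 x; apply/(@cvgrPdist_lt _ _ _ (nbhs x)) => e e0.
apply/enorm_nbhsP; exists e => // y yx.
rewrite (le_lt_trans _ yx)//.
have := dist_lip x y M0; have := dist_lip y x M0; rewrite (enormC x y).
by rewrite ler_norml => ? ?; apply/andP; split; lra.
Qed.

Lemma enorm_subl_continuous x : continuous (fun y => enorm (x - y)).
Proof.
move=> y; apply: (@cvg_comp _ _ _ (fun u => x - u) (@enorm R d) (nbhs y)
  (nbhs (x - y))); last exact: enorm_continuous.
exact: (cvgB (cvg_cst x) (@cvg_id _ (nbhs y))).
Qed.

Lemma closure_enormP y :
  closure M y <-> forall e : R, 0 < e -> exists2 z, M z & enorm (z - y) < e.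
Proof.
split=> [cy e e0|cy B /enorm_nbhsP[e e0 yB]].
  by have [z [Mz ze]] := cy _ (enorm_ball_nbhs y e0); exists z.
by have [z Mz ze] := cy _ e0; exists z; split => //; exact: yB.
Qed.

Lemma closure_dist_le x y : closure M y -> dist x M <= enorm (x - y).
Proof.
move=> /closure_enormP cy; apply/ler_addgt0Pr => e /cy[z Mz zy].
rewrite (le_trans (dist_le x Mz))// (le_trans (enorm_triangle y x z))//.
by rewrite lerD2l enormC ltW.
Qed.

(* Every sequence in [M] minimizing the distance to [x] converges to [z]. *)
Definition strong_proj x z := forall eps : R, 0 < eps ->
  exists2 kappa : R, 0 < kappa &
    forall y, M y -> enorm (x - y) < dist x M + kappa -> enorm (y - z) < eps.

Lemma calE_unpp x : calE M x -> unpp M x.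
Proof. exact: interior_subset. Qed.

Lemma unpp_eq x y z : unpp M x -> M y -> M z ->
  enorm (x - y) <= dist x M -> enorm (x - z) <= dist x M -> y = z.
Proof.
move=> [z0 [_ uz]] My Mz xy xz; rewrite -(uz y) ?(uz z)//.
  by split => //; apply/eqP; rewrite eq_le xz dist_le.
by split => //; apply/eqP; rewrite eq_le xy dist_le.
Qed.

(* If [y] were a nearest point in the closure only, then points slightly
   closer to [y] would have [y] as their only candidate, hence no projection. *)
Lemma calE_closure x y : calE M x -> closure M y ->
  enorm (x - y) <= dist x M -> M y.
Proof.
move=> Ex cy xy; have [z0 [[Mz0 xz0] _]] := calE_unpp Ex.
have M0 : M !=set0 by exists z0.
have [xy0|xy0] := eqVneq x y.
  suff -> : y = z0 by [].
  move: xz0; rewrite xy0; have := dist_le y Mz0.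
  have := xy; rewrite xy0 subrr enorm0 => d0 _ yz0.
  have yd : dist y M <= 0 by rewrite -(enorm0 (d := d)) -(subrr y) closure_dist_le.
  apply/eqP; rewrite -subr_eq0; apply/eqP/enorm_eq0/eqP.
  by rewrite eq_le enorm_ge0 yz0 yd.
have D0 : 0 < enorm (x - y) by rewrite enorm_gt0// subr_eq0.
set D := enorm (x - y) in xy D0.
move: Ex; rewrite /calE /interior => /enorm_nbhsP[e e0 Ee].
have [|h h0 [hle1 hle2]] := @common_lower_bound R 2^-1 (e / (2 * D)) _
  (divr_gt0 e0 (mulr_gt0 (ltr0Sn R 1) D0)); first by lra.
have h1 : h < 1 by lra.
have hD : h * D < e.
  by move: hle2; rewrite ler_pdivlMr ?mulr_gt0// => ?; lra.
pose x' := x - h *: (x - y).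
have [z [[Mz xz] _]] : unpp M x'.
  by apply: Ee; rewrite /x' addrC addKr enormN enormZ gtr0_norm// -/D.
have x'y : x' - y = (1 - h) *: (x - y).
  by rewrite /x' scalerBl scale1r addrAC.
have nx'y : enorm (x' - y) = (1 - h) * D.
  by rewrite x'y enormZ gtr0_norm// subr_gt0.
have xx' : x - x' = h *: (x - y) by rewrite /x' opprB addrCA subrr addr0.
have nxx' : enorm (x - x') = h * D by rewrite xx' enormZ gtr0_norm.
(* Here [z] is no farther from [x'] than [y] is, yet at least [D] away from [x]: equality in the
   triangle inequality forces [z = y]. *)
have : x' - z = ((1 - h) * D / enorm (x - x')) *: (x - x').
  apply: enorm_colinear.
  - by rewrite nxx' mulr_gt0.
  - by rewrite mulr_ge0 ?(ltW D0)// subr_ge0 ltW.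
  - by rewrite xz -nx'y closure_dist_le.
  - rewrite subrKA nxx' -mulrDl subrKC mul1r.
    by rewrite (le_trans xy)// dist_le.
rewrite nxx' xx' scalerA (_ : _ / _ * _ = 1 - h); last first.
  by field; rewrite !gt_eqF.
by rewrite -x'y => /addrI/oppr_inj <-.
Qed.

(** On the compact set [K] of closure points at least [eps] away from [z], the distance to [x]
    attains its minimum; if that were [dist x M], [calE_closure] would give a second nearest point
    in [M]. *)
Lemma calE_strong_proj x z : calE M x -> M z -> enorm (x - z) = dist x M ->
  strong_proj x z.
Proof.
move=> Ex Mz xz eps eps0.
have M0 : M !=set0 by exists z.
pose K := (closure M `&` [set y | eps <= enorm (z - y)]) `&`
  [set y | enorm (y - x) <= dist x M + 1].
have cK : compact K.
  rewrite /K setIC; apply: compact_closedI; first exact: enorm_closed_ball_compact.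
  apply: closedI; first exact: closed_closure.
  exact: ((continuous_closedP _).1 (@enorm_subl_continuous z) _ (@closed_ge _ eps)).
have inK y : M y -> enorm (x - y) <= dist x M + 1 -> eps <= enorm (y - z) -> K y.
  move=> My xy yz; split; last by rewrite /= enormC.
  by split; [exact: subset_closure|rewrite /= enormC].
have [K0|/set0P K0] := eqVneq K set0.
  exists 1 => // y My xy; rewrite ltNge; apply/negP => yz.
  by have := inK y My (ltW xy) yz; rewrite K0.
have cf : {within K, continuous (fun y => enorm (x - y))}.
  exact/continuous_subspaceT/enorm_subl_continuous.
have [y0] := compact_EVT_min K0 cK cf.
rewrite inE => -[[cy0 /= y0z] _] y0min.
have xy0 : dist x M < enorm (x - y0).
  rewrite ltNge; apply/negP => xy0.
  have My0 := calE_closure Ex cy0 xy0.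
  have y0E : y0 = z by apply: (unpp_eq (calE_unpp Ex)) => //; rewrite xz.
  by move: y0z; rewrite y0E subrr enorm0 leNgt eps0.
exists (Num.min 1 (enorm (x - y0) - dist x M)).
  by rewrite lt_min ltr01 subr_gt0.
move=> y My; rewrite -ltrBlDl lt_min !ltrBlDl subrKC => /andP[xy1 xy2].
rewrite ltNge; apply/negP => yz.
have := inK y My (ltW xy1) yz.
by rewrite -inE => /y0min; rewrite leNgt xy2.
Qed.

(* Points near [x] have a nearest point by local compactness of [M], and all
   their nearest points are near [z]. *)
Lemma calE_intro x z (rho e : R) : M z -> strong_proj x z ->
  0 < rho -> compact (M `&` [set y | enorm (y - z) <= rho]) ->
  0 < e -> (forall x' y1 y2, enorm (x' - x) < e -> M y1 -> M y2 ->
    enorm (y1 - z) < e -> enorm (y2 - z) < e ->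
    enorm (x' - y1) = dist x' M -> enorm (x' - y2) = dist x' M -> y1 = y2) ->
  calE M x.
Proof.
move=> Mz xz rho0 cM e0 Huniq; have M0 : M !=set0 by exists z.
have m0 : 0 < Num.min rho e by rewrite lt_min rho0.
have [k k0 kP] := xz _ m0.
(* Three losses of at most [k / 3] fit into [k]: passing from [x'] to [x], the change of [dist], and
   near-minimality. *)
apply/enorm_nbhsP; exists (Num.min e (k / 3)); first by rewrite lt_min e0 divr_gt0.
move=> x'; rewrite lt_min => /andP[x'e x'k].
have near_z y : M y -> enorm (x' - y) < dist x' M + k / 3 ->
    enorm (y - z) < rho /\ enorm (y - z) < e.
  move=> My x'y; apply/andP; rewrite -lt_min; apply: kP => //.
  have := enorm_triangle x' x y; have := dist_lip x' x M0.
  by rewrite (enormC x x'); lra.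
have [y1 My1 xy1] := dist_approx x' M0 (divr_gt0 k0 (ltr0Sn R 2)).
have K0 : (M `&` [set y | enorm (y - z) <= rho]) !=set0.
  by exists y1; split => //=; apply: ltW; have [] := near_z _ My1 xy1.
have cf : {within M `&` [set y | enorm (y - z) <= rho],
    continuous (fun y => enorm (x' - y))}.
  exact/continuous_subspaceT/enorm_subl_continuous.
have [y0] := compact_EVT_min K0 cM cf.
rewrite inE => -[My0 /= y0z] y0min.
have y01 : enorm (x' - y0) <= enorm (x' - y1).
  by apply: y0min; rewrite inE; split => //=; apply: ltW; have [] := near_z _ My1 xy1.
(* Points of [M] at distance at least [dist x' M + k / 3] from [x'] are farther than [y1], so the
   minimum over the compact piece is global. *)
have x'y0 : enorm (x' - y0) = dist x' M.
  apply/eqP; rewrite eq_le dist_le// andbT; apply: dist_ge => // y My.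
  have [xy|xy] := ltP (enorm (x' - y)) (dist x' M + k / 3).
    by apply: y0min; rewrite inE; split => //=; apply: ltW; have [] := near_z _ My xy.
  by rewrite (le_trans y01)// (le_trans (ltW xy1)).
have near_e y : M y -> enorm (x' - y) = dist x' M -> enorm (y - z) < e.
  by move=> My xy; have [] := near_z y My; rewrite // xy ltrDl divr_gt0.
exists y0; split => // y [My x'y]; apply: Huniq x'e _ _ _ _ _ _ => //; exact: near_e.
Qed.

End Distance.

(** * Normal rays inside the interior of unpp *)

Section Rays.
Context {R : realType} {d : nat}.
Variable M : set 'rV[R]_d.
Implicit Types x y z v : 'rV[R]_d.

Lemma open_segmentP z v (r : R) x : 0 < r ->
  open_segment z (z + r *: v) x <->
  exists2 t, 0 < t < r & x = z + t *: v.
Proof.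
move=> r0; rewrite /open_segment.
have E l : (1 - l) *: z + l *: (z + r *: v) = z + (l * r) *: v.
  by rewrite scalerBl scale1r scalerDr addrA subrK scalerA.
split=> [[l]|[t /andP[t0 tr] ->]].
  rewrite /= in_itv/= => /andP[l0 l1] <-; exists (l * r); last exact: E.
  by rewrite mulr_gt0// gtr_pMl.
exists (t / r); last by rewrite E divfK// gt_eqF.
by rewrite /= in_itv/= divr_gt0//= ltr_pdivrMr ?mul1r.
Qed.

(** Points of [M] with [enorm (x - y) >= D + k] stay far enough for small [h]. The others are close
    to [z], so moving away from [z] also moves away from them at rate at least [c]. *)
Lemma dist_slope x z (c : R) : M z -> strong_proj M x z ->
  enorm (x - z) = dist x M -> 0 < dist x M -> 0 <= c -> c < 1 ->
  exists2 h0, 0 < h0 & forall h, 0 < h -> h <= h0 ->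
    dist x M + c * h <= dist (x + (h / dist x M) *: (x - z)) M.
Proof.
move=> Mz xz xzE D0 c0 c1; have M0 : M !=set0 by exists z.
set D := dist x M in D0 *.
(* This radius around [z] ensures [dotp (x - z) (x - y) >= c * D ^+ 2]. *)
have [|k k0 kP] := xz ((1 - c) * D); first by rewrite mulr_gt0// subr_gt0.
exists (k / 2); first by rewrite divr_gt0.
move=> h h0 hk; apply: dist_ge => // y My.
have hD : enorm ((h / D) *: (x - z)) = h.
  by rewrite enormZ xzE -/D gtr0_norm ?divr_gt0// divfK// gt_eqF.
have [xy|xy] := ltP (enorm (x - y)) (D + k); last first.
  have := enorm_triangle (x + (h / D) *: (x - z)) x y.
  rewrite opprD addNKr enormN hD; nra.
have yz := kP y My xy.
have Dxy : D <= enorm (x - y) by exact: dist_le.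
have q : c * D ^+ 2 <= dotp (x - z) (x - y).
  rewrite -(subrKA z x (- y)) dotpDr -sqr_enorm xzE -/D.
  have := dotp_abs_le (x - z) (z - y).
  rewrite xzE -/D (enormC z y) ler_norml => /andP[+ _].
  nra.
have ch0 : 0 <= D + c * h by rewrite addr_ge0 ?mulr_ge0// ltW.
rewrite -(@ler_pXn2r _ 2)// ?nnegrE ?enorm_ge0//.
rewrite addrAC addrC sqr_enormD hD dotpZl.
have : h / D * (c * D ^+ 2) <= h / D * dotp (x - z) (x - y).
  by rewrite ler_wpM2l// divr_ge0// ltW.
rewrite (_ : h / D * (c * D ^+ 2) = h * c * D); last by field; rewrite gt_eqF.
have : D ^+ 2 <= enorm (x - y) ^+ 2 by rewrite ler_pXn2r ?nnegrE ?enorm_ge0// ltW.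
have : c ^+ 2 * h ^+ 2 <= h ^+ 2.
  by rewrite ler_piMl ?sqr_ge0// exprn_ile1// ltW.
nra.
Qed.

(* On a small closed ball around [x] the maximum [y] of [w |-> dist w M] cannot
   fall short of [dist x M + s]: otherwise [w |-> dist w M - c * enorm (w - x)]
   would have an interior maximum for some [c < 1], where the slope is 1. Then
   [y] lies on the ray from [z] through [x]. *)
Lemma dist_extend x z : calE M x -> M z -> enorm (x - z) = dist x M ->
  0 < dist x M -> exists2 s0 : R, 0 < s0 & forall s, 0 < s -> s < s0 ->
    dist x M + s <= dist (x + (s / dist x M) *: (x - z)) M.
Proof.
move=> Ex Mz xzE D0; have M0 : M !=set0 by exists z.
have /enorm_nbhsP[e e0 Ee] : nbhs x (calE M).
  by apply: open_nbhs_nbhs; split => //; exact: open_interior.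
have [s0 s00 [s0e s0D]] := common_lower_bound e0 D0.
exists s0 => // s sgt0 ss0.
pose B := [set y | enorm (y - x) <= s].
have Bx : B x by rewrite /B /= subrr enorm0 ltW.
have B0 : B !=set0 by exists x.
have cB : compact B := @enorm_closed_ball_compact _ _ x s.
have cx : continuous (fun y => enorm (y - x)).
  move=> y; rewrite (_ : (fun _ => _) = fun y => enorm (x - y)).
    exact: enorm_subl_continuous.
  by apply/funext => w; rewrite enormC.
have cdist : {within B, continuous (fun y => dist y M)}.
  exact/continuous_subspaceT/dist_continuous.
have [y] := compact_EVT_max B0 cB cdist; rewrite inE => By ymax.
have step c : 0 <= c -> c < 1 -> dist x M + c * s <= dist y M.
  move=> c0 c1.
  have cg : {within B, continuous (fun y => dist y M - c * enorm (y - x))}.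
    apply/continuous_subspaceT => w.
    exact: (cvgB (@dist_continuous _ _ M M0 w) (cvgM (cvg_cst c) (cx w))).
  have [w] := compact_EVT_max B0 cB cg; rewrite inE => Bw wmax.
  have := wmax x; rewrite inE => /(_ Bx); rewrite subrr enorm0 mulr0 subr0 => xw.
  have [ws|ws] := ltP (enorm (w - x)) s; last first.
    have wsE : enorm (w - x) = s by apply/eqP; rewrite eq_le ws andbT.
    have := ymax w; rewrite inE => /(_ Bw); rewrite wsE in xw; lra.
  have Ew : calE M w by apply: Ee; lra.
  have Dw : 0 < dist w M by have := mulr_ge0 c0 (enorm_ge0 (w - x)); lra.
  have [z' [[Mz' wz'] _]] := calE_unpp Ew.
  (* A slope strictly above [c] makes a further push by [h] gain more than the penalty [c * h],
     against the maximality of [w]. *)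
  have c'1 : (1 + c) / 2 < 1 by lra.
  have c'0 : 0 <= (1 + c) / 2 by lra.
  have [h0 h00 hP] :=
    dist_slope Mz' (calE_strong_proj Ew Mz' wz') wz' Dw c'0 c'1.
  have [|h hgt0 [hh0 hs]] := @common_lower_bound R h0 (s - enorm (w - x)) h00.
    by rewrite subr_gt0.
  pose w' := w + (h / dist w M) *: (w - z').
  have w'w : enorm (w' - w) = h.
    rewrite /w' addrC addKr enormZ wz' gtr0_norm ?divr_gt0// divfK// gt_eqF//.
  have w'x : enorm (w' - x) <= h + enorm (w - x).
    by rewrite -w'w; exact: enorm_triangle.
  have := wmax w'; rewrite inE => /(_ _) H.
  have : B w' by rewrite /B /=; lra.
  move=> /H; have := hP h hgt0 hh0; rewrite -/w'.
  have : c * enorm (w' - x) <= c * (h + enorm (w - x)) by rewrite ler_wpM2l.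
  nra.
have yD : dist x M + s <= dist y M.
  rewrite leNgt; apply/negP => yD.
  have xy : dist x M <= dist y M by apply: ymax; rewrite inE.
  (* The average slope reached at [y]; if it were below 1, [step] at the larger slope [(1 + a) / 2]
     would be violated. *)
  pose a := (dist y M - dist x M) / s.
  have aE : a * s = dist y M - dist x M by rewrite /a divfK// gt_eqF.
  have a0 : 0 <= a by rewrite divr_ge0 ?subr_ge0// ltW.
  have a1 : a < 1 by rewrite /a ltr_pdivrMr// mul1r; lra.
  have := step ((1 + a) / 2); nra.
suff <- : y = x + (s / dist x M) *: (x - z) by [].
rewrite -xzE -(@enorm_colinear _ _ (x - z) (y - x) s) ?subrKC ?xzE ?(ltW sgt0)//.
by rewrite [X in enorm X]addrC subrKA (le_trans yD)// dist_le.
Qed.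

(** Continuation: the parameters at which [z] is nearest form an initial interval, since [dist] is
    1-Lipschitz, and contain their supremum [tau]. If [tau < t0], [dist_extend] goes beyond it. The
    start [delta > 0] keeps the distance at [tau] positive. *)
Lemma normal_ray z v (r delta : R) : M z -> enorm v = 1 ->
  open_segment z (z + r *: v) `<=` calE M ->
  0 < delta -> delta <= dist (z + delta *: v) M ->
  forall t, 0 < t -> t < r -> t <= dist (z + t *: v) M.
Proof.
move=> Mz v1 Er d0 dP t0 t00 t0r; have M0 : M !=set0 by exists z.
have nv (a b : R) : enorm ((z + a *: v) - (z + b *: v)) = `|a - b|.
  by rewrite opprD addrACA subrr add0r -scalerBl enormZ v1 mulr1.
have zv (a : R) : enorm ((z + a *: v) - z) = `|a|.
  by rewrite addrC addKr enormZ v1 mulr1.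
pose S := [set t | t <= t0 /\ t <= dist (z + t *: v) M].
have down a b : a <= b -> b <= dist (z + b *: v) M -> a <= dist (z + a *: v) M.
  move=> ab bP; have := dist_lip (z + b *: v) (z + a *: v) M0.
  by rewrite nv ger0_norm ?subr_ge0//; lra.
have [t0d|dt0] := leP t0 delta; first exact: down dP.
have Sd : S delta by split => //; exact: ltW.
have hS : has_sup S by split; [exists delta|exists t0 => t []].
have ub : ubound S (sup S) by exact: sup_upper_bound.
have supt0 : sup S <= t0 by apply: ge_sup; [exists delta|move=> t []].
have dsup : delta <= sup S by exact: ub.
set tau := sup S in ub supt0 dsup *.
have Stau : tau <= dist (z + tau *: v) M.
  apply/ler_addgt0Pr => eps eps0.
  have [a Sa atau] := sup_adherent (divr_gt0 eps0 (ltr0Sn R 1)) hS.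
  have := dist_lip (z + a *: v) (z + tau *: v) M0.
  rewrite nv distrC ger0_norm ?subr_ge0; last exact: ub.
  have [_ aP] := Sa.
  rewrite -/tau in atau; lra.
have [tt0|t0t] := ltP tau t0; last by apply: (down _ tau).
pose x := z + tau *: v.
have tau0 : 0 < tau by exact: lt_le_trans dsup.
have xz : enorm (x - z) = tau by rewrite zv gtr0_norm.
have xd : dist x M = tau.
  by apply/eqP; rewrite eq_le Stau -[leRHS]xz dist_le.
have Ex : calE M x.
  apply: Er; apply/open_segmentP; first exact: lt_trans t0r.
  by exists tau; rewrite // tau0 (lt_trans tt0).
have xzd : enorm (x - z) = dist x M by rewrite xd.
have [|s0 s00 sP] := dist_extend Ex Mz xzd; first by rewrite xd.
have [||s sgt0 [ss0 st]] := @common_lower_bound R (s0 / 2) (t0 - tau).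
- by rewrite divr_gt0.
- by rewrite subr_gt0.
suff /ub : S (tau + s) by rewrite gerDl leNgt sgt0.
split; first by rewrite addrC -lerBrDr.
have := sP s sgt0; rewrite xd.
rewrite (_ : x + _ = z + (tau + s) *: v); first by apply; lra.
rewrite (_ : x - z = tau *: v); last by rewrite /x addrC addKr.
by rewrite scalerA divfK ?gt_eqF// /x -addrA -scalerDl.
Qed.

End Rays.

(** * Calculus along segments *)

Section Calculus.
Context {R : realType} {d : nat}.
Local Notation V := 'rV[R]_d.

Lemma is_derive_line (W : normedModType R) (f : V -> W) (y e : V) (s : R) :
  derivable f (y + s *: e) e ->
  is_derive s 1 (fun t : R => f (y + t *: e)) ('D_e f (y + s *: e)).
Proof.
move=> df.
have E : (fun h : R => h^-1 *: (((fun t : R => f (y + t *: e)) \o shift s) (h *: 1)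
      - f (y + s *: e))) =
    (fun h : R => h^-1 *: ((f \o shift (y + s *: e)) (h *: e) - f (y + s *: e))).
  apply/funext => h /=; congr (_ *: (f _ - _)).
  by rewrite [h%:A]mulr1 scalerDl addrCA.
by split; rewrite /derivable /derive E.
Qed.

Lemma is_derive_coord (f : R -> V) (s : R) (df : V) (i : 'I_d) :
  is_derive s 1 f df -> is_derive s 1 (fun t => f t 0 i) (df 0 i).
Proof.
move=> [fs dfs]; split; first exact: ((derivable_mxP _ _ _).1 fs 0 i).
by rewrite -dfs derive_mx// mxE.
Qed.

Lemma is_derive_dotp (f g : R -> V) (s : R) (df dg : V) :
  is_derive s 1 f df -> is_derive s 1 g dg ->
  is_derive s 1 (fun t => dotp (f t) (g t)) (dotp df (g s) + dotp (f s) dg).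
Proof.
move=> fs gs.
have -> : (fun t => dotp (f t) (g t)) =
    \sum_(i < d) ((fun t => f t 0 i) * (fun t => g t 0 i)).
  by apply/funext => t; rewrite fct_sumE.
have H (i : 'I_d) := is_deriveM (is_derive_coord i fs) (is_derive_coord i gs).
apply: (is_derive_eq (is_derive_sum H)).
rewrite -big_split/=; apply: eq_bigr => i _.
by rewrite addrC; congr (_ + _); rewrite [LHS]mulrC.
Qed.

Lemma is_derive_dotpr (u : V) (f : R -> V) (s : R) (df : V) :
  is_derive s 1 f df -> is_derive s 1 (fun t => dotp u (f t)) (dotp u df).
Proof.
move=> fs; apply: is_derive_eq; first exact: (is_derive_dotp (is_derive_cst u s 1) fs).
by rewrite dotp0l add0r.
Qed.

Lemma is_derive_continuous (f : R -> R) (s df : R) :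
  is_derive s 1 f df -> {for s, continuous f}.
Proof. by move=> [fs _]; apply/differentiable_continuous/derivable1_diffP. Qed.

Lemma MVT_derive (f df : R -> R) (a b : R) : a < b ->
  (forall s, a <= s <= b -> is_derive s 1 f (df s)) ->
  exists2 s, a < s < b & f b - f a = df s * (b - a).
Proof.
move=> ab fP.
have [||s sab ->] := @MVT _ f df a b ab.
- by move=> s; rewrite in_itv/= => /andP[? ?]; apply: fP; rewrite !ltW.
- apply: continuous_in_subspaceT => s; rewrite inE/= in_itv/= => sab.
  exact: is_derive_continuous (fP _ sab).
- by exists s.
Qed.

(** Pairing with a fixed [u] reduces a vector-valued map to the scalar mean value theorem. *)
Lemma MVT_segment_dotp (f : V -> V) (y e u : V) :
  (forall s : R, 0 <= s <= 1 -> differentiable f (y + s *: e)) ->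
  exists2 s : R, 0 < s < 1 &
    dotp u (f (y + e) - f y) = dotp u ('D_e f (y + s *: e)).
Proof.
move=> fd.
have [|s s01 E] := @MVT_derive (fun s => dotp u (f (y + s *: e)))
  (fun s => dotp u ('D_e f (y + s *: e))) 0 1 ltr01.
  move=> s s01; apply: is_derive_dotpr; apply: is_derive_line.
  exact/diff_derivable/fd.
exists s => //.
by move: E; rewrite scale1r scale0r addr0 subr0 mulr1 -dotpBr.
Qed.

Lemma derive_scale (f : V -> V) (x e : V) (a : R) : differentiable f x ->
  'D_(a *: e) f x = a *: 'D_e f x.
Proof. by move=> fx; rewrite !deriveE// linearZ. Qed.

Lemma derive_delta (f : V -> V) (x e : V) : differentiable f x ->
  'D_e f x = \sum_(i < d) e 0 i *: 'D_(delta_mx 0 i) f x.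
Proof.
move=> fx; rewrite deriveE// {1}(row_sum_delta e) linear_sum.
by apply: eq_bigr => i _; rewrite linearZ deriveE.
Qed.

Lemma Ck1_locally_lipschitz (f : V -> V) (A : set V) (x : V) :
  open A -> A x -> Ck 1 f A ->
  exists2 r : R, 0 < r & exists2 C : R, 0 < C &
    [/\ forall y, enorm (y - x) < r -> A y,
        forall y e, enorm (y - x) < r -> enorm ('D_e f y) <= C * enorm e &
        forall y z, enorm (y - x) < r -> enorm (z - x) < r ->
          enorm (f y - f z) <= C * enorm (y - z)].
Proof.
move=> oA Ax [fd fc].
have /enorm_nbhsP[r1 r10 r1A] : nbhs x A by apply: open_nbhs_nbhs.
pose D i := 'D_(delta_mx 0 i) f.
have /enorm_nbhsP[r2 r20 r2D] : nbhs x [set y | forall i : 'I_d,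
    enorm (D i y) < enorm (D i x) + 1].
  apply: (@filter_forall _ _ (fun i y => enorm (D i y) < enorm (D i x) + 1) (nbhs x)) => i.
  have /(_ _ _)/= := @cvg_comp _ _ _ (D i) (@enorm R d) (nbhs x) (nbhs (D i x))
    (nbhs (enorm (D i x))) (fc _ x Ax) (@enorm_continuous _ _ _).
  by move=> /(_ [set t | t < enorm (D i x) + 1]); apply; apply: lt_nbhsl; rewrite ltrDl.
have [r r0 [rr1 rr2]] := common_lower_bound r10 r20.
(* The partial derivatives near [x] exceed their norms at [x] by less than 1; the final 1 makes [C]
   positive even for an empty sum. *)
pose C := \sum_(i < d) (enorm (D i x) + 1) + 1.
have C0 : 0 < C.
  by rewrite ltr_wpDl// sumr_ge0// => i _; rewrite addr_ge0// enorm_ge0.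
have rA y : enorm (y - x) < r -> A y by move=> yr; apply: r1A; lra.
have DC y e : enorm (y - x) < r -> enorm ('D_e f y) <= C * enorm e.
  move=> yr; rewrite derive_delta; last exact/fd/rA.
  rewrite (le_trans (enorm_sum _ _ _))// /C mulrDl.
  rewrite ler_wpDr ?mulr_ge0 ?enorm_ge0// mulr_suml.
  apply: ler_sum => i _; rewrite enormZ mulrC ler_pM ?enorm_ge0//.
    by apply/ltW/r2D; lra.
  exact: le_trans (coord_le_normr e i) (normr_le_enorm e).
exists r => //; exists C => //; split => // y z yr zr.
have [->|fyz] := eqVneq (f y) (f z).
  by rewrite subrr enorm0 mulr_ge0 ?enorm_ge0// ltW.
have seg (s : R) (s01 : 0 <= s <= 1) := enorm_ball_convex zr yr s01.
(* The increment is paired with itself, which produces its squared norm. *)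
have [|s s01] := @MVT_segment_dotp f z (y - z) (f y - f z).
  by move=> s s01; apply/fd/rA/seg.
rewrite subrKC -sqr_enorm expr2 => E.
rewrite -(@ler_pM2l _ (enorm (f y - f z))) ?enorm_gt0 ?subr_eq0// E.
rewrite (le_trans (dotp_le _ _))// ler_wpM2l ?enorm_ge0// DC//.
by apply: seg; case/andP: s01 => *; rewrite !ltW.
Qed.

End Calculus.

(** * Charts and tangent spaces *)

Definition flat (R : realType) (d m : nat) (y : 'rV[R]_d) : Prop :=
  forall i : 'I_d, (m <= i)%N -> y 0 i = 0.

(** Chart data with the inverse made explicit and both cancellation laws stated pointwise. *)
Definition flat_chart (R : realType) (d k m : nat) (M U V : set 'rV[R]_d)
    (Psi Phi : 'rV[R]_d -> 'rV[R]_d) : Prop :=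
  [/\ open U /\ open V, Ck k Psi V /\ Ck k Phi U,
      forall y, V y -> U (Psi y) /\ Phi (Psi y) = y,
      forall z, U z -> V (Phi z) /\ Psi (Phi z) = z &
      forall y, V y -> (M (Psi y) <-> flat m y)].

Section Charts.
Context {R : realType} {d : nat}.
Local Notation E := 'rV[R]_d.
Implicit Types (M U V : set 'rV[R]_d) (Psi Phi : 'rV[R]_d -> 'rV[R]_d).
Implicit Types (x y z e n v w : 'rV[R]_d).

Lemma submanifold_chart k m M z : Ck_submanifold k m M -> M z ->
  exists U V Psi Phi, flat_chart k m M U V Psi Phi /\ U z.
Proof.
move=> [_ _ MP] /MP[U [V [Psi [oU oV Uz [bPsi cPsi [Phi [PhiK cPhi]]] PsiP]]]].
have [fPsi _ sPsi] := bPsi.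
exists U, V, Psi, Phi; split => //; split => //.
  by move=> y Vy; split; [exact: fPsi|apply: PhiK; rewrite inE].
by move=> w /sPsi[y Vy <-]; rewrite PhiK ?inE.
Qed.

Lemma flatD m y e : flat m y -> flat m e -> flat m (y + e).
Proof. by move=> fy fe i mi; rewrite mxE fy// fe// addr0. Qed.

Lemma flatZ m (a : R) e : flat m e -> flat m (a *: e).
Proof. by move=> fe i mi; rewrite mxE fe// mulr0. Qed.

Lemma flatB m y e : flat m y -> flat m e -> flat m (y - e).
Proof. by move=> fy fe i mi; rewrite !mxE fy// fe// subr0. Qed.

Lemma Ck1_derive_line (f : E -> E) (A : set E) y e (r : R) : Ck 1 f A ->
  (forall t : R, t \in `]- r, r[ -> A (y + t *: e)) ->
  Ck 1 (fun t : R => f (y + t *: e)) `]- r, r[.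
Proof.
move=> [fd fc] Ar.
have cd (t : R) : t \in `]- r, r[ -> is_derive t 1 (fun t : R => f (y + t *: e))
    ('D_e f (y + t *: e)).
  by move=> tr; apply: is_derive_line; exact/diff_derivable/fd/Ar.
have cdiff (t : R) : t \in `]- r, r[ ->
    differentiable (fun t : R => f (y + t *: e)) t.
  by move=> /cd[ct _]; exact/derivable1_diffP.
split=> [t tr|v t tr]; first exact: cdiff.
have cv (s : R) : s \in `]- r, r[ ->
    'D_v (fun t : R => f (y + t *: e)) s = v *: 'D_e f (y + s *: e).
  move=> sr; rewrite -[v in LHS]mulr1 -[v * 1]/(v *: 1) deriveE; last exact: cdiff.
  by rewrite linearZ -deriveE; [have [_ ->] := cd s sr|exact: cdiff].
have H : (v *: 'D_e f (y + s *: e)) @[s --> t] -->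
    'D_v (fun t : R => f (y + t *: e)) t.
  rewrite cv//.
  suff H : 'D_e f (y + s *: e) @[s --> t] --> 'D_e f (y + t *: e) by exact: cvgZl_tmp H.
  apply: (@cvg_comp _ _ _ (fun s : R => y + s *: e) ('D_e f) _ (nbhs (y + t *: e))).
    exact: (cvgD (cvg_cst y) (@scalel_continuous _ _ e t)).
  by apply: fc; exact: Ar.
(* The formula [cv] holds only on the open interval, so continuity is transferred through local
   equality. *)
apply: cvg_trans H; apply: near_eq_cvg.
apply: filterS (near_in_itvoo tr) => s sr; exact/esym/cv.
Qed.

(** Flat vectors form a subspace, so the chart image of a short segment in direction [e] is a curve
    in [M] with this velocity. *)
Lemma tangent_chart m M U V Psi Phi y e : flat_chart 1 m M U V Psi Phi ->
  V y -> flat m y -> flat m e -> tangent_space M (Psi y) ('D_e Psi y).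
Proof.
move=> [[_ oV] [cPsi _] _ _ PsiP] Vy fy fe.
have /enorm_nbhsP[r r0 rV] : nbhs y V by apply: open_nbhs_nbhs.
have e1 : 0 < enorm e + 1 by rewrite ltr_wpDl// enorm_ge0.
pose r' := r / (enorm e + 1).
have Vt (t : R) : t \in `]- r', r'[ -> V (y + t *: e).
  rewrite in_itv/= -ltr_norml => tr; apply: rV.
  rewrite addrC addKr enormZ; move: tr; rewrite ltr_pdivlMr//.
  by have := normr_ge0 t; nra.
have r'0 : 0 < r' by rewrite divr_gt0.
exists r', (fun t : R => Psi (y + t *: e)); split.
- exact: r'0.
- exact: Ck1_derive_line cPsi Vt.
- move=> t tr; apply/PsiP; first exact: Vt.
  exact/flatD/flatZ.
- by rewrite scale0r addr0.
- have [cd _] := cPsi.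
  have [|_] := @is_derive_line _ _ _ Psi y e 0.
    by rewrite scale0r addr0; exact/diff_derivable/cd.
  by rewrite derive1E scale0r addr0.
Qed.

(** First-order condition: along a curve in [M] through [z] the squared distance to [x] is minimal
    at parameter 0, where its derivative is [- 2 * dotp (x - z) w]. *)
Lemma tangent_orthogonal M x z w : (forall y, M y -> enorm (x - z) <= enorm (x - y)) ->
  tangent_space M z w -> dotp (x - z) w = 0.
Proof.
move=> zmin [e [c [e0 [cd _] cM c0 cw]]].
have c'0 (t : R) : t \in `]- e, e[ -> is_derive t 1 c ('D_1 c t).
  by move=> te; apply/derivableP/diff_derivable/cd.
have xc (t : R) : t \in `]- e, e[ -> is_derive t 1 (fun t => x - c t) (0 - 'D_1 c t).
  by move=> te; apply: is_deriveB; exact: c'0.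
have g' (t : R) (te : t \in `]- e, e[) := is_derive_dotp (xc t te) (xc t te).
have z0 : (0 : R) \in `]- e, e[ by rewrite in_itv/= oppr_lt0 e0.
have [|||_] := @derive1_at_min R (fun t => dotp (x - c t) (x - c t)) (- e) e 0 _ _ z0.
- by rewrite lerNl (le_trans _ (ltW e0))// oppr_le0 ltW.
- by move=> t te; have [] := g' t te.
- move=> t te; rewrite -!sqr_enorm ler_pXn2r ?nnegrE ?enorm_ge0// c0.
  by apply: zmin; exact: cM.
have [_ ->] := g' 0 z0.
rewrite -derive1E c0 cw sub0r dotpNl dotpNr (dotpC w); lra.
Qed.

(** Chain rule for [Phi \o Psi], the identity near [y]. It shows that the derivative of [Psi] is
    injective and bounds it from below. *)
Lemma chart_derive_inverse m M U V Psi Phi y e : flat_chart 1 m M U V Psi Phi ->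
  V y -> 'D_('D_e Psi y) Phi (Psi y) = e.
Proof.
move=> [[_ oV] [[dPsi _] [dPhi _]] VU _ _] Vy.
have [Uy PhiK] := VU y Vy.
have dP := dPsi y Vy; have dQ := dPhi _ Uy.
rewrite (deriveE _ dQ) (deriveE _ dP).
transitivity ('D_e (Phi \o Psi) y).
  have E1 := deriveE e (differentiable_comp dP dQ).
  have E2 := congr1 (fun h : E -> E => h e) (diff_comp dP dQ).
  exact: etrans (esym E2) (esym E1).
rewrite -[RHS](derive_id y e); apply: near_eq_derive.
apply: (@filterS _ (nbhs y) _ V); last exact: open_nbhs_nbhs.
by move=> w /VU[].
Qed.

(** Flatness is a closed condition: by continuity of [Phi], a limit in [U] of points of [M] has flat
    coordinates, so [M] is closed in a small ball. *)
Lemma chart_local_compact m M U V Psi Phi z : flat_chart 1 m M U V Psi Phi ->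
  U z -> exists2 r : R, 0 < r & compact (M `&` [set y | enorm (y - z) <= r]).
Proof.
move=> [[oU _] [_ cPhi] VU UV MP] Uz.
have /enorm_nbhsP[r r0 rU] : nbhs z U by apply: open_nbhs_nbhs.
exists (r / 2); first by rewrite divr_gt0.
apply: (subclosed_compact _ (@enorm_closed_ball_compact _ _ z (r / 2))); last first.
  by move=> y [].
move=> w cw.
have wz : enorm (w - z) <= r / 2.
  apply/ler_addgt0Pr => eps eps0.
  have [y [[_ /= yz] yw]] := cw _ (enorm_ball_nbhs w eps0).
  by have := enorm_triangle y w z; rewrite (enormC w y); move: yw => /=; lra.
have Uw : U w by apply: rU; lra.
split => //; have [Vw <-] := UV w Uw; apply/MP => // i mi.
have [r1 r10 [C C0 [_ _ lip]]] := Ck1_locally_lipschitz oU Uw cPhi.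
apply/eqP; rewrite -normr_le0; apply/ler_addgt0Pr => eps eps0; rewrite add0r.
have [r2 r20 [r21 r2e]] := common_lower_bound r10 (divr_gt0 eps0 C0).
have [y [[My /= yz] /= yw]] := cw _ (enorm_ball_nbhs w r20).
have Uy : U y by apply: rU; lra.
have [Vy PsiK] := UV y Uy.
have y0 : Phi y 0 i = 0 by apply: ((MP _ Vy).1 _ i mi); rewrite PsiK.
have -> : Phi w 0 i = (Phi w - Phi y) 0 i by rewrite !mxE y0 oppr0 addr0.
rewrite (le_trans (coord_le_normr _ _))// (le_trans (normr_le_enorm _))//.
rewrite (le_trans (lip _ _ _ _)) ?subrr ?enorm0//; first by lra.
rewrite mulrC -ler_pdivlMr// enormC; lra.
Qed.

(** The unit direction [u] of [w] is within about [delta] of a unit vector [t2] of [T2], and [n]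
    only sees the difference [u - t2]. *)
Lemma subspace_dist_dotp (T1 T2 : set E) (delta : R) n w :
  subspace_dist T1 T2 <= delta -> T2 `&` @usphere R d !=set0 ->
  (forall t, T2 t -> dotp n t = 0) -> T1 ((enorm w)^-1 *: w) ->
  dotp n w <= delta * enorm n * enorm w.
Proof.
move=> T12 T20 nT2.
have [->|w0] := eqVneq w 0; first by rewrite dotp0r enorm0 mulr0.
have wgt0 := enorm_gt0 w0.
set u := _ *: w => T1u.
have u1 : enorm u = 1 by rewrite enormZ gtr0_norm ?invr_gt0// mulVf// gt_eqF.
have -> : dotp n w = enorm w * dotp n u by rewrite dotpZr mulrA divff ?gt_eqF// mul1r.
rewrite mulrC ler_pM2r// mulrC.
have hinf (t : E) : has_inf [set enorm (t2 - t) | t2 in T2 `&` @usphere R d].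
  split; first by have [t2 t2P] := T20; exists (enorm (t2 - t)), t2.
  by exists 0 => _ [t2 _ <-]; exact: enorm_ge0.
have infu : inf [set enorm (t2 - u) | t2 in T2 `&` @usphere R d] <= delta.
  apply: le_trans T12; apply: ub_le_sup; last by exists u.
  (* Unit vectors are at most 2 apart, so the supremum is taken over a bounded set and dominates its
     members. *)
  exists 2 => _ [t [_ t1] <-]; have [t2 [T2t2 t21]] := T20.
  apply: (@le_trans _ _ (enorm (t2 - t))).
    by apply: ge_inf; [have [] := hinf t|exists t2].
  by rewrite (le_trans (enormD _ _))// enormN t1 t21.
apply/ler_addgt0Pr => eps eps0.
have n1 : 0 < enorm n + 1 by rewrite ltr_wpDl// enorm_ge0.
have [_ [t2 [T2t2 _] <-] t2u] := inf_adherent (divr_gt0 eps0 n1) (hinf u).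
have -> : dotp n u = dotp n (u - t2) by rewrite dotpBr (nT2 t2)// subr0.
rewrite (le_trans (dotp_le _ _))// enormC.
have H : enorm (t2 - u) <= delta + eps / (enorm n + 1) by lra.
rewrite (le_trans (ler_wpM2l (enorm_ge0 n) H))// mulrDr mulrC lerD2l.
by rewrite mulrA ler_pdivrMr//; have := enorm_ge0 n; nra.
Qed.

(* Along the chart segment from [z] to [y] the velocities are tangent to [M],
   hence nearly tangent to [M] at [z]. *)
Lemma normal_deviation m M z0 : C11_submanifold m M -> M z0 ->
  exists2 r : R, 0 < r & exists2 C : R, 0 < C & forall z y n, M z -> M y ->
    enorm (z - z0) < r -> enorm (y - z0) < r ->
    (forall t, tangent_space M z t -> dotp n t = 0) ->
    dotp n (y - z) <= C * enorm n * enorm (y - z) ^+ 2.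
Proof.
move=> [m0 Msub ML] Mz0; have [W [L [oW Wz0 L0 LP]]] := ML z0 Mz0.
have [U [V [Psi [Phi [ch Uz0]]]]] := submanifold_chart Msub Mz0.
have [[oU oV] [cPsi cPhi] VU UV MP] := ch.
have [Vz0 z0K] := UV z0 Uz0.
have md : (m < d)%N by case: Msub.
have [r1 r10 [A A0 [r1V DA lipA]]] := Ck1_locally_lipschitz oV Vz0 cPsi.
have [r2 r20 [B B0 [r2U _ lipB]]] := Ck1_locally_lipschitz oU Uz0 cPhi.
have /enorm_nbhsP[r3 r30 r3W] : nbhs z0 W by apply: open_nbhs_nbhs.
(* Radii are chosen backwards: [Phi] maps the [r]-ball into the [r4]-ball, which [Psi] maps into
   [W]. *)
have [r4 r40 [r41 r43]] := common_lower_bound r10 (divr_gt0 r30 A0).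
have [r r0 [rr2 rr4]] := common_lower_bound r20 (divr_gt0 r40 B0).
(* Both [enorm (Psi p - z)] and the velocity at [p] are at most [A * B * enorm (y - z)]; [L] turns
   the former into a distance of tangent spaces. *)
exists r => //; exists (L * (A ^+ 2 * B ^+ 2)); first by rewrite !mulr_gt0 ?exprn_gt0.
move=> z y n Mz My zr yr nT.
have nearPhi w : enorm (w - z0) < r -> enorm (Phi w - Phi z0) < r4.
  move=> wr; have := lipB w z0; rewrite subrr enorm0 => /(_ _ r20) H.
  apply: le_lt_trans (H _) _; first by lra.
  by rewrite mulrC -ltr_pdivlMr//; lra.
have inU w : enorm (w - z0) < r -> U w by move=> wr; apply: r2U; lra.
have [Vz PsiKz] := UV z (inU z zr); have [Vy PsiKy] := UV y (inU y yr).
have fz : flat m (Phi z) by apply/MP; rewrite ?PsiKz.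
have fy : flat m (Phi y) by apply/MP; rewrite ?PsiKy.
pose e := Phi y - Phi z.
have fe : flat m e by exact: flatB.
have seg (s : R) : 0 <= s <= 1 -> enorm (Phi z + s *: e - Phi z0) < r4.
  by move=> s01; apply: enorm_ball_convex => //; exact: nearPhi.
have segV (s : R) : 0 <= s <= 1 -> V (Phi z + s *: e).
  by move=> /seg sr; apply: r1V; lra.
have [|s s01] := @MVT_segment_dotp _ _ Psi (Phi z) e n.
  by move=> s /segV; case: cPsi => + _; apply.
rewrite subrKC PsiKz PsiKy => ->.
have {}s01 : 0 <= s <= 1 by case/andP: s01 => *; rewrite !ltW.
set p := Phi z + s *: e.
have fp : flat m p by exact/flatD/flatZ.
have pr4 : enorm (p - Phi z0) < r4 := seg s s01.
have Vp : V p by exact: segV.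
have Mp : M (Psi p) by apply/MP.
have Wp : W (Psi p).
  apply: r3W; have := lipA p (Phi z0); rewrite subrr enorm0 z0K => /(_ _ r10) H.
  apply: le_lt_trans (H _) _; first by lra.
  by rewrite mulrC -ltr_pdivlMr//; lra.
have Wz : W z.
  apply: r3W; have := lipA (Phi z) (Phi z0).
  rewrite subrr enorm0 z0K PsiKz => /(_ _ r10) H.
  have := nearPhi z zr => Pz; apply: le_lt_trans (H _) _; first by lra.
  by rewrite mulrC -ltr_pdivlMr//; lra.
(* As [m > 0], the first coordinate vector is flat, and its image under the injective derivative is
   a nonzero tangent vector. *)
have tz : tangent_space M z `&` @usphere R d !=set0.
  pose i0 := Ordinal (leq_ltn_trans (leq0n m) md).
  have f0 : flat m (delta_mx 0 i0 : E).
    by move=> i mi; rewrite mxE eqxx/= -val_eqE/=; case: (val i) (leq_trans m0 mi).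
  set w := 'D_(delta_mx 0 i0) Psi (Phi z).
  have w0 : w != 0.
    apply/eqP => w0; have := chart_derive_inverse (delta_mx 0 i0) ch Vz.
    rewrite -/w w0 derive0 => /matrixP/(_ 0 i0)/eqP.
    by rewrite !mxE !eqxx eq_sym oner_eq0.
  exists ((enorm w)^-1 *: w); split.
    rewrite -[z in tangent_space M z]PsiKz /w -derive_scale; last first.
      by case: cPsi => + _; apply.
    by apply: tangent_chart ch _ _ _ => //; exact: flatZ.
  by rewrite /usphere/= enormZ ger0_norm ?invr_ge0 ?enorm_ge0// mulVf// gt_eqF// enorm_gt0.
have Lpz := LP _ _ (conj Wp Mp) (conj Wz Mz).
set w := 'D_e Psi p.
have Tw : tangent_space M (Psi p) ((enorm w)^-1 *: w).
  rewrite /w -derive_scale; last by case: cPsi => + _; apply.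
  by apply: tangent_chart ch _ _ _ => //; exact: flatZ.
have H := subspace_dist_dotp Lpz tz nT Tw.
apply: le_trans H _.
have He : enorm e <= B * enorm (y - z) by apply: lipB; lra.
have Hw : enorm w <= A * enorm e by apply: DA; lra.
have Hp : enorm (Psi p - z) <= A * enorm e.
  have Pz := nearPhi z zr.
  rewrite -{1}PsiKz; apply: le_trans (lipA _ _ _ _) _; [lra|lra|].
  rewrite ler_pM2l// /p addrC addKr enormZ ger0_norm; last by case/andP: s01.
  by rewrite ler_piMl ?enorm_ge0//; case/andP: s01.
have n0 := enorm_ge0 n; have e0 := enorm_ge0 e.
have Hpw : enorm (Psi p - z) * enorm w <= (A * B * enorm (y - z)) ^+ 2.
  rewrite expr2 -(mulrA A B); apply: ler_pM; rewrite ?enorm_ge0//.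
    by rewrite (le_trans Hp)// ler_pM2l.
  by rewrite (le_trans Hw)// ler_pM2l.
rewrite (_ : L * _ * _ * _ = L * enorm n * (enorm (Psi p - z) * enorm w)); last by ring.
rewrite (_ : _ * _ ^+ 2 = L * enorm n * (A * B * enorm (y - z)) ^+ 2); last by ring.
by rewrite ler_wpM2l// mulr_ge0// ltW.
Qed.

End Charts.

(** * Submanifolds of class C^{1,1} *)

Section FrontierC11.
Context {R : realType} {d m : nat}.
Variable M : set 'rV[R]_d.
Hypothesis hM : C11_submanifold m M.
Implicit Types (z y v : 'rV[R]_d) (p q : 'rV[R]_d * 'rV[R]_d).

Lemma C11_nonempty : M !=set0.
Proof. by case: hM => _ []. Qed.

(* If [y1], [y2] are both nearest to [x], then [enorm (y2 - y1) ^+ 2] equals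
   [2 * dotp (x - y1) (y2 - y1)], which [normal_deviation] makes too small. *)
Lemma C11_sub_calE : M `<=` calE M.
Proof.
move=> z Mz.
have [r r0 [C C0 dev]] := normal_deviation hM Mz.
have [U [V [Psi [Phi [ch Uz]]]]] : exists U V Psi Phi,
    flat_chart 1 m M U V Psi Phi /\ U z.
  by case: hM => _ sub _; exact: submanifold_chart sub Mz.
have [rho rho0 cM] := chart_local_compact ch Uz.
have zz : strong_proj M z z.
  move=> eps eps0; exists eps => // y My; rewrite enormC => H.
  apply: lt_le_trans H _.
  have := dist_le z Mz; rewrite subrr enorm0; lra.
have C2 : 0 < (2 * C)^-1 by rewrite invr_gt0 mulr_gt0.
have [e e0 [er eC]] := common_lower_bound r0 C2.
apply: (calE_intro Mz zz rho0 cM e0) => x y1 y2 xz My1 My2 y1z y2z xy1 xy2.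
have T1 t : tangent_space M y1 t -> dotp (x - y1) t = 0.
  by apply: tangent_orthogonal => y My; rewrite xy1 dist_le.
have := dev y1 y2 (x - y1) My1 My2 (lt_le_trans y1z er) (lt_le_trans y2z er) T1.
have : enorm (x - y2) ^+ 2 = enorm (x - y1) ^+ 2 by rewrite xy1 xy2.
rewrite -[x - y2](subrKA y1) -[y1 - y2]opprB (sqr_enormB (x - y1)) => E dy.
have xe : enorm (x - y1) < e by rewrite xy1 (le_lt_trans (dist_le x Mz)).
apply/esym/eqP; rewrite -subr_eq0; apply/eqP/enorm_eq0/eqP.
rewrite -sqrf_eq0 eq_le sqr_ge0 andbT leNgt; apply/negP => y12.
have : 2 * C * enorm (x - y1) < 1.
  have : 2 * C * e <= 1 by rewrite mulrC -ler_pdivlMr ?mulr_gt0// div1r.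
  have : 2 * C * enorm (x - y1) < 2 * C * e by rewrite ltr_pM2l// mulr_gt0.
  lra.
rewrite -(ltr_pM2r y12) mul1r; lra.
Qed.

(** Expanding the squared distance from [z + e v] to [y] near [z], [normal_deviation] and
    [2 * C * e <= 1] keep it at least [e^2]; points beyond [r] are out of reach since [e <= r / 2].
    This starts the continuation in [normal_ray]. *)
Lemma nu1_short_ray p : nu1 M p ->
  exists2 delta : R, 0 < delta & delta <= dist (p.1 + delta *: p.2) M.
Proof.
case: p => z v [/= Mz vT v1].
have [r r0 [C C0 dev]] := normal_deviation hM Mz.
have C2 : 0 < (2 * C)^-1 by rewrite invr_gt0 mulr_gt0.
have [e e0 [er eC]] := common_lower_bound (divr_gt0 r0 (ltr0Sn R 1)) C2.
exists e => //; apply: dist_ge; first exact: C11_nonempty.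
move=> y My; have ev : enorm (e *: v) = e by rewrite enormZ v1 mulr1 gtr0_norm.
have [yz|yz] := ltP (enorm (y - z)) r; last first.
  have := enorm_triangle (z + e *: v) y z.
  rewrite [z + _ - z]addrC addKr ev (enormC y (_ + _)); lra.
rewrite -(@ler_pXn2r _ 2)// ?nnegrE ?enorm_ge0 ?(ltW e0)//.
rewrite addrAC -opprB addrC sqr_enormB ev dotpZl.
have := dev z y v Mz My _ yz vT; rewrite subrr enorm0 v1 => /(_ r0) H.
have : 2 * C * e <= 1 by rewrite mulrC -ler_pdivlMr ?mulr_gt0// div1r.
have : e * dotp v (y - z) <= e * (C * 1 * enorm (y - z) ^+ 2) by rewrite ler_pM2l.
have := sqr_ge0 (enorm (y - z)); nra.
Qed.

Lemma nu1_ray p (r : R) : nu1 M p ->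
  open_segment p.1 (p.1 + r *: p.2) `<=` calE M ->
  forall t, 0 < t -> t < r -> t <= dist (p.1 + t *: p.2) M.
Proof.
move=> np Er; have [delta d0 dP] := nu1_short_ray np.
by case: np => Mp _ v1; exact: normal_ray Er d0 dP.
Qed.

Lemma frontier_gtP p (a : R) : (a%:E < frontier_fun M p)%E <->
  exists2 r : R, a < r & 0 < r /\ open_segment p.1 (p.1 + r *: p.2) `<=` calE M.
Proof.
split=> [/ereal_sup_gt[_ [r rP <-]]|[r ar rP]].
  by rewrite lte_fin => ar; exists r.
rewrite (@lt_le_trans _ _ r%:E) ?lte_fin//.
by apply: ereal_sup_ubound; exists r.
Qed.

Lemma frontier_gt0 p : nu1 M p -> (0 < frontier_fun M p)%E.
Proof.
case: p => z v [/= Mz _ v1].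
have /enorm_nbhsP[e e0 eP] : nbhs z (calE M).
  by apply: open_nbhs_nbhs; split; [exact: open_interior|exact: C11_sub_calE].
apply/frontier_gtP; exists e => //; split => // x.
move=> /(open_segmentP _ _ _ e0)[t /andP[t0 te] ->]; apply: eP.
by rewrite /= addrC addKr enormZ v1 mulr1 gtr0_norm.
Qed.

(** Tube argument: the points at parameters in the compact [[0, b]] lie in the open set [calE M],
    the foot point by [C11_sub_calE], so one neighborhood of [p] serves all of them. *)
Lemma frontier_lsc p (a : R) : nu1 M p -> (a%:E < frontier_fun M p)%E ->
  \forall q \near p, (a%:E < frontier_fun M q)%E.
Proof.
move=> np apr.
have [r [r0 ar Er]] : exists r, [/\ 0 < r, a < r &
    open_segment p.1 (p.1 + r *: p.2) `<=` calE M].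
  by move/frontier_gtP: apr => [r ar [r0 Er]]; exists r.
(* The maximum with 0 keeps [b] positive when [a] is negative. *)
pose b := (Num.max a 0 + r) / 2.
have [ab b0 br] : [/\ a < b, 0 < b & b < r].
  by rewrite /b; have [a0|a0] := leP a 0; split; lra.
have cK : compact `[0, b] by exact: segment_compact.
have := (compact_near_coveringP _).1 cK _ (nbhs p)
  (fun q t => calE M (q.1 + t *: q.2)) _.
have Hloc (t : R) : `[0, b]%classic t ->
    \forall t' \near t & q \near p, calE M (q.1 + t' *: q.2).
  rewrite /= in_itv/= => /andP[t0 tb].
  have Et : nbhs (p.1 + t *: p.2) (calE M).
    apply: open_nbhs_nbhs; split; first exact: open_interior.
    have [->|tn0] := eqVneq t 0.
      by rewrite scale0r addr0; apply: C11_sub_calE; case: np.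
    apply: Er; apply/open_segmentP => //; exists t => //.
    by rewrite lt_neqAle eq_sym tn0 t0 (le_lt_trans tb).
  have H : (fun z : R * ('rV[R]_d * 'rV[R]_d) => z.2.1 + z.1 *: z.2.2) @
      filter_prod (nbhs t) (nbhs p) --> p.1 + t *: p.2.
    have c1 : (fun z : R * ('rV[R]_d * 'rV[R]_d) => z.2.1) @
      filter_prod (nbhs t) (nbhs p) --> p.1.
      exact: (cvg_comp _ _ (@cvg_snd _ _ (nbhs t) (nbhs p) _) cvg_fst).
    have c2 : (fun z : R * ('rV[R]_d * 'rV[R]_d) => z.2.2) @
      filter_prod (nbhs t) (nbhs p) --> p.2.
      exact: (cvg_comp _ _ (@cvg_snd _ _ (nbhs t) (nbhs p) _) cvg_snd).
    exact: (cvgD c1 (cvgZ (@cvg_fst _ _ (nbhs t) (nbhs p) _) c2)).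
  exact: H Et.
move=> /(_ (nbhs_filter p) Hloc); apply: (@filterS _ (nbhs p)) => q qP.
apply/frontier_gtP; exists b => //; split => // x.
move=> /(open_segmentP _ _ _ b0)[t /andP[t0 tb] ->]; apply: qP.
by rewrite /= in_itv/= !ltW.
Qed.

End FrontierC11.

(** * Submanifolds of class C^2 *)

(** If [k < 0], the derivative [g] is negative just to the right of 0, and the mean value theorem
    makes [f] drop below [f 0]. *)
Lemma second_order_min (R : realType) (f g : R -> R) (k r : R) : 0 < r ->
  (forall s : R, 0 <= s < r -> is_derive s 1 f (g s)) -> g 0 = 0 ->
  is_derive (0 : R) 1 g k -> (forall s, 0 <= s < r -> f 0 <= f s) -> 0 <= k.
Proof.
move=> r0 fg g0 [gd gk] fmin; rewrite leNgt; apply/negP => k0.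
have : (fun h : R => h^-1 *: ((g \o shift 0) (h *: (1 : R)) - g 0)) @ 0^' --> k.
  by rewrite -gk; exact: gd.
move=> /(_ [set y | y < 0]) /(_ (lt_nbhsl k0)) [e /= e0 eP].
have [h h0 [he hr]] := @common_lower_bound R (e / 2) (r / 2)
  (divr_gt0 e0 (ltr0Sn R 1)) (divr_gt0 r0 (ltr0Sn R 1)).
have gneg s : 0 < s -> s <= h -> g s < 0.
  move=> s0 sh; have := eP s.
  rewrite /= sub0r normrN gtr0_norm// g0 subr0 addr0 [s *: 1]mulr1 => /(_ _ _).
  have se : s < e by lra.
  move=> /(_ se (lt0r_neq0 s0)); rewrite -[_ *: _]/(_ * _) pmulr_rlt0 ?invr_gt0//.
have [|s /andP[s0 sh]] := @MVT_derive R f g 0 h h0.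
  by move=> s /andP[s0 sh]; apply: fg; rewrite s0/=; lra.
rewrite subr0 => E.
have : g s * h < 0 by rewrite pmulr_llt0// gneg// ltW.
rewrite -E subr_lt0 ltNge => /negP; apply; apply: fmin.
by rewrite (ltW h0)/=; lra.
Qed.

(** * Second derivatives of the squared distance in a chart *)

Section SecondOrder.
Context {R : realType} {d m : nat}.
Local Notation E := 'rV[R]_d.
Variables (M U V : set 'rV[R]_d) (Psi Phi : 'rV[R]_d -> 'rV[R]_d).
Hypothesis ch2 : flat_chart 2 m M U V Psi Phi.
Implicit Types (x y z e v : 'rV[R]_d).

Lemma flat_chart2_1 : flat_chart 1 m M U V Psi Phi.
Proof.
have C21 (f : E -> E) A : Ck 2 f A -> Ck 1 f A.
  move=> [fd fc]; split => // v x Ax; have [fvd _] := fc v.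
  exact/differentiable_continuous/fvd.
by case: ch2 => oUV [cPsi cPhi] VU UV MP; split => //; split; exact: C21.
Qed.

(* First and second derivative of [enorm (Psi _ - x) ^+ 2 / 2] at [y] in the
   direction [e]. *)
Definition chart_grad x y e : R := dotp (Psi y - x) ('D_e Psi y).

Definition chart_hess x y e : R :=
  dotp ('D_e Psi y) ('D_e Psi y) + dotp (Psi y - x) ('D_e ('D_e Psi) y).

Lemma is_derive_chart_sqdist x y e (s : R) : V (y + s *: e) ->
  is_derive s 1 (fun t : R => enorm (Psi (y + t *: e) - x) ^+ 2 / 2)
    (chart_grad x (y + s *: e) e).
Proof.
move=> Vs; case: ch2 => _ [[dPsi _] _] _ _ _.
have H1 : is_derive s 1 (fun t : R => Psi (y + t *: e)) ('D_e Psi (y + s *: e)).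
  exact/is_derive_line/diff_derivable/dPsi.
have H2 := is_deriveB H1 (is_derive_cst x s 1).
have H3 := is_deriveZ (2^-1) (is_derive_dotp H2 H2).
rewrite (_ : (fun _ => _) = 2^-1 \*: (fun t : R =>
  dotp (Psi (y + t *: e) - x) (Psi (y + t *: e) - x))); last first.
  by apply/funext => t; rewrite sqr_enorm mulrC.
apply: (is_derive_eq H3).
rewrite -[LHS]/(2^-1 * _) subr0 /chart_grad (dotpC ('D_e Psi _)); lra.
Qed.

Lemma is_derive_chart_grad x y e (s : R) : V (y + s *: e) ->
  is_derive s 1 (fun t : R => chart_grad x (y + t *: e) e)
    (chart_hess x (y + s *: e) e).
Proof.
move=> Vs; case: ch2 => _ [[dPsi ddPsi] _] _ _ _.
have H1 : is_derive s 1 (fun t : R => Psi (y + t *: e)) ('D_e Psi (y + s *: e)).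
  exact/is_derive_line/diff_derivable/dPsi.
have H2 : is_derive s 1 (fun t : R => 'D_e Psi (y + t *: e))
    ('D_e ('D_e Psi) (y + s *: e)).
  by apply/is_derive_line/diff_derivable; have [+ _] := ddPsi e; apply.
apply: (is_derive_eq (is_derive_dotp (is_deriveB H1 (is_derive_cst x s 1)) H2)).
by rewrite /chart_hess subr0.
Qed.

Lemma chart_grad_eq0 x y e : V y -> flat m y -> flat m e ->
  (forall z, M z -> enorm (x - Psi y) <= enorm (x - z)) -> chart_grad x y e = 0.
Proof.
move=> Vy fy fe xy; rewrite /chart_grad -opprB dotpNl.
rewrite (tangent_orthogonal xy) ?oppr0//.
exact: tangent_chart flat_chart2_1 _ _ _.
Qed.

Lemma chart_hess_ge0 x y e : V y -> flat m y -> flat m e ->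
  (forall z, M z -> enorm (x - Psi y) <= enorm (x - z)) -> 0 <= chart_hess x y e.
Proof.
move=> Vy fy fe xy.
have [[_ oV] _ _ _ MP] := ch2.
have /enorm_nbhsP[r r0 rV] : nbhs y V by apply: open_nbhs_nbhs.
have e1 : 0 < enorm e + 1 by rewrite ltr_wpDl// enorm_ge0.
have Vt (t : R) : 0 <= t < r / (enorm e + 1) -> V (y + t *: e).
  move=> /andP[t0]; rewrite ltr_pdivlMr// => tr; apply: rV.
  rewrite addrC addKr enormZ ger0_norm//; nra.
have r'0 : 0 < r / (enorm e + 1) by rewrite divr_gt0.
have y0 : y + (0 : R) *: e = y by rewrite scale0r addr0.
have V0 : V (y + (0 : R) *: e) by rewrite y0.
have gd := is_derive_chart_grad x V0.
rewrite -[y]y0.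
apply: (second_order_min r'0 (fun s sr => is_derive_chart_sqdist x (Vt s sr)) _ gd).
  by rewrite y0; exact: chart_grad_eq0.
move=> s sr; rewrite y0 ler_pM2r ?invr_gt0// !(enormC _ x).
rewrite ler_pXn2r ?nnegrE ?enorm_ge0//; apply: xy.
by apply/MP; [exact: Vt|exact/flatD/flatZ].
Qed.

(** Coefficients of the quadratic form [chart_hess], as functions of the pair of [x] and [y] to
    express joint continuity. *)
Definition hess_coef (p : E * E) (ij : 'I_d * 'I_d) : R :=
  dotp ('D_(delta_mx 0 ij.1) Psi p.2) ('D_(delta_mx 0 ij.2) Psi p.2)
  + dotp (Psi p.2 - p.1) ('D_(delta_mx 0 ij.2) ('D_(delta_mx 0 ij.1) Psi) p.2).

Lemma chart_hessE x y e : V y ->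
  chart_hess x y e = \sum_i \sum_j e 0 i * e 0 j * hess_coef (x, y) (i, j).
Proof.
move=> Vy; have [[_ oV] [[dPsi ddPsi] _] _ _ _] := ch2.
have D2 : 'D_e ('D_e Psi) y =
    \sum_i \sum_j (e 0 i * e 0 j) *: 'D_(delta_mx 0 j) ('D_(delta_mx 0 i) Psi) y.
  (* The expansion of ['D_e Psi] in partial derivatives holds on [V], hence near [y], and may be
     differentiated again. *)
  transitivity ('D_e (\sum_i (e 0 i \*: 'D_(delta_mx 0 i) Psi)) y).
    apply: near_eq_derive; apply: (@filterS _ (nbhs y) _ V); last exact: open_nbhs_nbhs.
    by move=> w Vw; rewrite derive_delta ?fct_sumE//; exact: dPsi.
  have dd i : differentiable ('D_(delta_mx 0 i) Psi) y.
    by have [+ _] := ddPsi (delta_mx 0 i); apply.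
  rewrite derive_sum; last by move=> i; exact/derivableZ/diff_derivable/dd.
  apply: eq_bigr => i _; rewrite deriveZ; last exact/diff_derivable/dd.
  rewrite derive_delta// scaler_sumr; apply: eq_bigr => j _.
  by rewrite scalerA.
rewrite /chart_hess D2 derive_delta; last exact: dPsi.
rewrite dotp_suml dotp_sumr -big_split/=; apply: eq_bigr => i _.
rewrite !dotp_sumr -big_split/=; apply: eq_bigr => j _.
by rewrite dotpZl !dotpZr /hess_coef/= mulrDr mulrA.
Qed.

Lemma hess_coef_continuous x y ij : V y ->
  (fun p => hess_coef p ij) @ nbhs (x, y) --> hess_coef (x, y) ij.
Proof.
move=> Vy; have [_ [[dPsi ddPsi] _] _ _ _] := ch2.
have c2 : (fun p : E * E => p.2) @ nbhs (x, y) --> y by exact: cvg_snd.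
have c1 : (fun p : E * E => p.1) @ nbhs (x, y) --> x by exact: cvg_fst.
have c (f : E -> E) : differentiable f y \/ {for y, continuous f} ->
    (fun p : E * E => f p.2) @ nbhs (x, y) --> f y.
  move=> fy; apply: (@cvg_comp _ _ _ (fun p : E * E => p.2) f (nbhs (x, y))
    (nbhs y) (nbhs (f y)) c2).
  by case: fy => // /differentiable_continuous.
have cP := c Psi (or_introl (dPsi y Vy)).
have cD v := c ('D_v Psi) (or_introl ((ddPsi v).1 y Vy)).
have cDD v w := c ('D_w ('D_v Psi)) (or_intror ((ddPsi v).2 w y Vy)).
exact: (cvgD (dotp_cvg (cD _) (cD _)) (dotp_cvg (cvgB cP c1) (cDD _ _))).
Qed.

(** Each of the [d^2] coefficients moves by less than [eta / k] and is weighted by at most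
    [enorm e ^+ 2], whence uniformity in [e]. The 1 in [k] covers [d = 0]. *)
Lemma chart_hess_lsc x y (eta : R) : V y -> 0 < eta ->
  exists2 r : R, 0 < r & forall x' y', enorm (x' - x) < r -> enorm (y' - y) < r ->
    V y' /\ forall e, chart_hess x y e - eta * enorm e ^+ 2 <= chart_hess x' y' e.
Proof.
move=> Vy eta0; have [[_ oV] _ _ _ _] := ch2.
pose k : R := d%:R ^+ 2 + 1.
have k0 : 0 < k by rewrite /k ltr_wpDl// sqr_ge0.
have : \forall p \near nbhs (x, y), forall ij,
    `|hess_coef (x, y) ij - hess_coef p ij| < eta / k.
  apply: (@filter_forall _ _ (fun ij p => `|hess_coef (x, y) ij - hess_coef p ij| < eta / k)
    (nbhs (x, y))) => ij.
  have /(@cvgrPdist_lt _ _ _ (nbhs (x, y))) := @hess_coef_continuous x y ij Vy.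
  by apply; rewrite divr_gt0.
move=> [[A B] /= [/enorm_nbhsP[r1 r10 r1A] /enorm_nbhsP[r2 r20 r2B]] AB].
have /enorm_nbhsP[r3 r30 r3V] : nbhs y V by apply: open_nbhs_nbhs.
have [r4 r40 [r41 r42]] := common_lower_bound r10 r20.
have [r r0 [rr4 rr3]] := common_lower_bound r40 r30.
exists r => // x' y' xr yr.
have Vy' : V y' by apply: r3V; lra.
split => // e; rewrite (chart_hessE _ _ Vy) (chart_hessE _ _ Vy') lerBlDr -lerBlDl.
rewrite -sumrB.
have -> : eta * enorm e ^+ 2 = eta * enorm e ^+ 2 / k * k by rewrite divfK// gt_eqF.
apply: (@le_trans _ _ (\sum_(i < d) \sum_(j < d) enorm e ^+ 2 * (eta / k))).
  apply: ler_sum => i _; rewrite -sumrB; apply: ler_sum => j _.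
  rewrite -mulrBr (le_trans (ler_norm _))// normrM ler_pM//.
    rewrite normrM expr2 ler_pM//;
      exact: le_trans (coord_le_normr _ _) (normr_le_enorm _).
  apply/ltW/(AB (x', y')); split => /=; [apply: r1A; lra|apply: r2B; lra].
rewrite !sumr_const !card_ord -mulrnA -mulr_natr natrM -expr2.
rewrite (_ : enorm e ^+ 2 * (eta / k) = eta * enorm e ^+ 2 / k); last by ring.
apply: ler_wpM2l; last by rewrite /k lerDl.
by rewrite divr_ge0 ?(ltW k0)// mulr_ge0 ?sqr_ge0// ltW.
Qed.

End SecondOrder.

(* A point strictly before the end of a segment that realizes the distance to
   [M] is not focal: the Hessian of the squared distance is positive definite
   there, so that the squared distance to nearby points is strictly convex in
   the chart and has a single minimizer. *)
Lemma C2_ray_calE (R : realType) (d m : nat) (M : set 'rV[R]_d) (z v : 'rV[R]_d)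
    (b t : R) : Ck_submanifold 2 m M -> M z -> enorm v = 1 -> 0 < t -> t < b ->
  (forall y, M y -> b <= enorm (z + b *: v - y)) -> calE M (z + t *: v).
Proof.
move=> Msub Mz v1 t0 tb bP; have M0 : M !=set0 by exists z.
have b0 : 0 < b by exact: lt_trans tb.
have [U [V [Psi [Phi [ch2 Uz]]]]] := submanifold_chart Msub Mz.
have ch := flat_chart2_1 ch2.
have [[oU oV] [_ cPhi] VU UV MP] := ch.
have [Vz PsiKz] := UV z Uz.
have fz : flat m (Phi z) by apply/MP; rewrite ?PsiKz.
set x := z + t *: v.
have xz : x - z = t *: v by rewrite /x addrC addKr.
have nxz : enorm (x - z) = t by rewrite xz enormZ v1 mulr1 gtr0_norm.
have c0 : 0 < 1 - t / b by rewrite subr_gt0 ltr_pdivrMr// mul1r.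
have sq (a : R) y : enorm (z + a *: v - y) ^+ 2 =
    a ^+ 2 - 2 * (a * dotp v (y - z)) + enorm (y - z) ^+ 2.
  have -> : z + a *: v - y = a *: v - (y - z) by apply/rowP => i; rewrite !mxE; ring.
  by rewrite (sqr_enormB (a *: v)) enormZ v1 mulr1 real_normK ?num_real// dotpZl.
(* Minimality at [z + b v] gives [2 b <v, y - z> <= |y - z|^2]; scaling by [t / b] leaves quadratic
   growth with factor [1 - t / b]. *)
have sqdist y : M y -> t ^+ 2 + (1 - t / b) * enorm (y - z) ^+ 2 <= enorm (x - y) ^+ 2.
  move=> My; have : b ^+ 2 <= enorm (z + b *: v - y) ^+ 2.
    by rewrite ler_pXn2r ?nnegrE ?enorm_ge0 ?(ltW b0) ?bP.
  rewrite !sq => H.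
  have : t / b * (2 * (b * dotp v (y - z))) <= t / b * enorm (y - z) ^+ 2.
    by apply: ler_wpM2l; [rewrite divr_ge0 ?ltW|lra].
  rewrite (_ : t / b * (2 * _) = 2 * (t * dotp v (y - z))); last first.
    by field; rewrite gt_eqF.
  lra.
have dx : dist x M = t.
  apply/eqP; rewrite eq_le -{1}nxz dist_le//=; apply: dist_ge => // y My.
  rewrite -(@ler_pXn2r _ 2) ?nnegrE ?enorm_ge0 ?(ltW t0)//.
  by apply: le_trans (sqdist y My); rewrite lerDl mulr_ge0 ?sqr_ge0// ltW.
have strong : strong_proj M x z.
  move=> eps eps0.
  (* With [k <= 1], [(t + k)^2 - t^2 <= (2 t + 1) k <= (1 - t / b) eps^2]. *)
  have [||k k0 [k1 kP]] := @common_lower_bound R 1 ((1 - t / b) * eps ^+ 2 / (2 * t + 1)).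
  - by [].
  - by rewrite divr_gt0 ?mulr_gt0 ?exprn_gt0// addr_gt0// mulr_gt0.
  exists k => // y My; rewrite dx => xy.
  have : enorm (x - y) ^+ 2 < (t + k) ^+ 2.
    by rewrite ltr_pXn2r ?nnegrE ?enorm_ge0// ltW// addr_gt0.
  have := sqdist y My; move: kP; rewrite ler_pdivlMr; last by rewrite addr_gt0// mulr_gt0.
  move=> kP H1 H2; rewrite -(@ltr_pXn2r _ 2)// ?nnegrE ?enorm_ge0 ?(ltW eps0)//.
  rewrite -(ltr_pM2l c0); nra.
have [rho rho0 cM] := chart_local_compact ch Uz.
have [r1 r10 [C C0 [r1U DC lipC]]] := Ck1_locally_lipschitz oU Uz cPhi.
pose c := (1 - t / b) / C ^+ 2.
have cgt0 : 0 < c by rewrite divr_gt0// exprn_gt0.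
(* With [a] the norm of the velocity, the Hessian is [a^2 - t q] at [x] and [a^2 - b q >= 0] at
   [z + b v]. Interpolation leaves [(1 - t / b) a^2], and [enorm e <= C * a]. *)
have hess e : flat m e -> c * enorm e ^+ 2 <= chart_hess Psi x (Phi z) e.
  move=> fe.
  have zmin (y : 'rV[R]_d) : M y ->
      enorm (z + b *: v - Psi (Phi z)) <= enorm (z + b *: v - y).
    by move=> My; rewrite PsiKz addrC addKr enormZ v1 mulr1 gtr0_norm// bP.
  have := chart_hess_ge0 ch2 Vz fz fe zmin.
  have zb : z - (z + b *: v) = - (b *: v) by rewrite opprD addNKr.
  rewrite /chart_hess PsiKz zb -[z - x]opprB xz.
  rewrite -sqr_enorm !dotpNl !dotpZl => H.
  have eD : enorm e <= C * enorm ('D_e Psi (Phi z)).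
    rewrite -{1}(chart_derive_inverse e ch Vz) PsiKz.
    by apply: DC; rewrite subrr enorm0.
  set a := enorm ('D_e Psi (Phi z)) in H eD *.
  set q := dotp v _ in H *.
  have eD2 : enorm e ^+ 2 <= C ^+ 2 * a ^+ 2.
    by rewrite -exprMn ler_pXn2r ?nnegrE ?enorm_ge0// mulr_ge0 ?enorm_ge0// ltW.
  have cE : c * (C ^+ 2 * a ^+ 2) = (1 - t / b) * a ^+ 2.
    by rewrite /c; field; rewrite !gt_eqF.
  have : c * enorm e ^+ 2 <= c * (C ^+ 2 * a ^+ 2) by rewrite ler_pM2l.
  rewrite cE => /le_trans; apply.
  have : 0 <= t / b * (a ^+ 2 - b * q) by rewrite mulr_ge0// divr_ge0 ?ltW.
  rewrite (_ : t / b * (_ - _) = t / b * a ^+ 2 - t * q); first by lra.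
  by field; rewrite gt_eqF.
(* Half of the convexity constant is given up to the perturbation of [x] and [Phi z]. *)
have c2 : 0 < c / 2 by rewrite divr_gt0.
have [r2 r20 r2P] := chart_hess_lsc ch2 x Vz c2.
have [r3 r30 [r31 r32]] := common_lower_bound r10 (divr_gt0 r20 C0).
have [e e0 [er3 er2]] := common_lower_bound r30 r20.
apply: (calE_intro Mz strong rho0 cM e0) => x' y1 y2 x'x My1 My2 y1z y2z xy1 xy2.
have near_z y : M y -> enorm (y - z) < e ->
    [/\ V (Phi y), Psi (Phi y) = y, flat m (Phi y) & enorm (Phi y - Phi z) < r2].
  move=> My yz; have Uy : U y by apply: r1U; lra.
  have [Vy PsiKy] := UV y Uy; split => //; first by apply/MP; rewrite ?PsiKy.
  have := lipC y z; rewrite subrr enorm0 => /(_ _ r10) H.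
  apply: le_lt_trans (H _) _; first by lra.
  by rewrite mulrC -ltr_pdivlMr//; lra.
have [V1 K1 f1 n1] := near_z y1 My1 y1z.
have [V2 K2 f2 n2] := near_z y2 My2 y2z.
pose w := Phi y2 - Phi y1.
have fw : flat m w by exact: flatB.
have xr2 : enorm (x' - x) < r2 by lra.
have seg (s : R) : 0 <= s <= 1 -> V (Phi y1 + s *: w) /\
    c / 2 * enorm w ^+ 2 <= chart_hess Psi x' (Phi y1 + s *: w) w.
  move=> s01; have sr := enorm_ball_convex n1 n2 s01.
  have [Vs Hs] := r2P x' _ xr2 sr; split => //.
  apply: le_trans (Hs w); have := hess w fw; lra.
have g0 : chart_grad Psi x' (Phi y1) w = 0.
  by apply: (chart_grad_eq0 ch2) => // y My; rewrite K1 xy1 dist_le.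
have g1 : chart_grad Psi x' (Phi y2) w = 0.
  by apply: (chart_grad_eq0 ch2) => // y My; rewrite K2 xy2 dist_le.
(* The gradient vanishes at both nearest points, so the Hessian vanishes somewhere between them in
   direction [w]. *)
have [|s /andP[s0 s1]] := @MVT_derive R (fun s => chart_grad Psi x' (Phi y1 + s *: w) w)
    (fun s => chart_hess Psi x' (Phi y1 + s *: w) w) 0 1 ltr01.
  by move=> s /seg[Vs _]; exact: (is_derive_chart_grad ch2 x' Vs).
rewrite scale1r scale0r addr0 subrKC g0 g1 subrr subr0 mulr1 => H.
have [|_] := seg s; first by rewrite !ltW.
rewrite -H => w0; rewrite -K1 -K2; congr Psi; apply/esym/eqP.
rewrite -subr_eq0; apply/eqP/enorm_eq0/eqP; rewrite -sqrf_eq0 eq_le sqr_ge0 andbT.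
by rewrite -(ler_pM2l c2) mulr0.
Qed.

(** * Upper semicontinuity and continuity of the frontier function *)

Lemma cvg_ereal_semicontinuous (R : realType) (T : Type) (F : set_system T)
    (u : T -> \bar R) (l : \bar R) : Filter F ->
  (forall a : R, (a%:E < l)%E -> \forall x \near F, (a%:E < u x)%E) ->
  (forall b : R, (l < b%:E)%E -> \forall x \near F, (u x < b%:E)%E) ->
  u @ F --> l.
Proof.
move=> FF lo up A; case: l lo up => [l| |] lo up /=.
- move=> [e /= e0 eA].
  have lo' := lo (l - e); have up' := up (l + e).
  rewrite !lte_fin ltrBlDr ltrDl in lo' up'.
  apply: (filterS2 _ _ (lo' e0) (up' e0)) => x.
  rewrite /=; case: (u x) => [r| |] //; rewrite !lte_fin => h1 h2; apply: eA => /=.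
  by rewrite distrC ltr_distl h1.
- by move=> [a [_ aA]]; apply: filterS (lo a (ltry a)) => x; exact: aA.
- by move=> [a [_ aA]]; apply: filterS (up a (ltNyr a)) => x; exact: aA.
Qed.

Lemma frontier_usc (R : realType) (d m : nat) (M : set 'rV[R]_d)
    (p : 'rV[R]_d * 'rV[R]_d) (b : R) :
  C11_submanifold m M -> Ck_submanifold 2 m M -> nu1 M p ->
  (frontier_fun M p < b%:E)%E ->
  \forall q \near p, nu1 M q -> (frontier_fun M q < b%:E)%E.
Proof.
move=> hM M2 np pb.
(* The intermediate [c] leaves room for the weak inequality obtained near [p]. *)
have [c [c0 pc cb]] : exists c : R, [/\ 0 < c, (frontier_fun M p < c%:E)%E & c < b].
  have := frontier_gt0 hM np; move: pb; case: (frontier_fun M p) => [r| |]//.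
  rewrite !lte_fin => rb r0; exists ((r + b) / 2); rewrite !lte_fin; split; lra.
(* Otherwise [z] is nearest to [z + c v], and [C2_ray_calE] gives a frontier value of at least
   [c]. *)
have [y My yc] : exists2 y, M y & enorm (p.1 + c *: p.2 - y) < c.
  apply: contrapT => noy.
  have cP y : M y -> c <= enorm (p.1 + c *: p.2 - y).
    by move=> My; rewrite leNgt; apply/negP => yc; apply: noy; exists y.
  move: pc; rewrite ltNge => /negP; apply; apply: ereal_sup_ubound.
  exists c => //; split => // x /(open_segmentP _ _ _ c0)[t /andP[t0 tc] ->].
  by case: np => Mp _ v1; exact: C2_ray_calE M2 Mp v1 t0 tc cP.
have H : (fun q : 'rV[R]_d * 'rV[R]_d => q.1 + c *: q.2) @ nbhs p --> p.1 + c *: p.2.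
  have c1 : (fun q : 'rV[R]_d * 'rV[R]_d => q.1) @ nbhs p --> p.1 by exact: cvg_fst.
  have c2 : (fun q : 'rV[R]_d * 'rV[R]_d => q.2) @ nbhs p --> p.2 by exact: cvg_snd.
  exact: (cvgD c1 (cvgZ (cvg_cst c) c2)).
have /enorm_nbhsP Hn : exists2 e : R, 0 < e &
    forall w, enorm (w - (p.1 + c *: p.2)) < e -> enorm (w - y) < c.
  exists (c - enorm (p.1 + c *: p.2 - y)); first by rewrite subr_gt0.
  by move=> w wp; have := enorm_triangle (p.1 + c *: p.2) w y; lra.
have := H _ Hn; apply: (@filterS _ (nbhs p)) => q /= qc nq.
apply: (@le_lt_trans _ _ c%:E); last by rewrite lte_fin.
(* A frontier value above [c] at [q] would put [q.1 + c *: q.2] at distance at least [c] from [M],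
   but [y] is closer. *)
rewrite leNgt; apply/negP => /frontier_gtP[r cr [r0 Er]].
have := nu1_ray hM nq Er c0 cr; rewrite leNgt => /negP; apply.
exact: le_lt_trans (dist_le _ My) qc.
Qed.

Theorem theorem1 (R : realType) (d m : nat) (M : set 'rV[R]_d)
    (hM : C11_submanifold m M) :
  [/\ (forall p, nu1 M p -> (0 < frontier_fun M p)%E),
      lower_semicontinuous (frontier_fun M : subspace (nu1 M) -> \bar R) &
      (Ck_submanifold 2 m M -> {within nu1 M, continuous (frontier_fun M)})].
Proof.
split=> [p||M2 p].
- exact: frontier_gt0 hM _.
- move=> p a ap; exists [set q | (a%:E < frontier_fun M q)%E] => //.
  (* Points outside [nu1 M] are isolated in the [subspace] topology, so there the claim is
     trivial. *)
  case: (nbhs_subspaceP (nu1 M) p) => [np|_]; last by move=> q ->.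
  exact: filterS (fun q aq _ => aq) (frontier_lsc hM np ap).
suff : frontier_fun M @ nbhs (p : subspace (nu1 M)) --> frontier_fun M p by [].
case: (nbhs_subspaceP (nu1 M) p) => [np|_]; last first.
  by move=> A /nbhs_singleton Ap q ->.
apply: cvg_ereal_semicontinuous => [a ap|b pb].
  exact: filterS (fun q aq _ => aq) (frontier_lsc hM np ap).
exact: frontier_usc hM M2 np pb.
Qed.
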